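(* Let $n\ge3$, $2^*=\frac{2n}{n-2}$, $1\le k\le n$, and let $\mathbb{R}^n_{k_+}=\{x\in\mathbb{R}^n: x_1>0,\ldots,x_k>0\}$. There exists a constant $C>0$ such that for every $u\in C_0^\infty(\mathbb{R}^n_{k_+})$ \[ \int_{\mathbb{R}^n_{k_+}}|\nabla u|^2dx\ \ge\ \frac14\int_{\mathbb{R}^n_{k_+}}\left(\frac1{x_1^2}+\cdots+\frac1{x_k^2}\right)|u|^2dx+C\left(\int_{\mathbb{R}^n_{k_+}}|u|^{2^*}dx\right)^{2/2^*}. \] *)

(* Defs.v *)
From HB Require Import structures.
From mathcomp Require Import all_boot all_order all_algebra.
From mathcomp Require Import all_classical all_reals all_analysis.
Set Implicit Arguments. Unset Strict Implicit. Unset Printing Implicit Defensive.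
Import Order.TTheory GRing.Theory Num.Theory numFieldNormedType.Exports.
Local Open Scope classical_set_scope.
Local Open Scope ring_scope.

Section Defs.
Variable R : realType.

Definition Rnkplus (n k : nat) : set 'rV[R]_n :=
  [set x | forall i : 'I_n, (i < k)%N -> 0 < x ord0 i].

Definition partial (n : nat) (i : 'I_n) (f : 'rV[R]_n -> R) : 'rV[R]_n -> R :=
  fun x => 'D_(delta_mx ord0 i) f x.

Definition iter_partial (n : nat) (s : seq 'I_n) (f : 'rV[R]_n -> R) :=
  foldr (fun i g => partial i g) f s.

(* C^infinity: all iterated partial derivatives exist and are (Frechet)
   differentiable everywhere (hence continuous) *)
Definition smooth (n : nat) (f : 'rV[R]_n -> R) : Prop :=
  forall (s : seq 'I_n) (x : 'rV[R]_n), differentiable (iter_partial s f) x.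

Definition Cc_infty (n : nat) (Omega : set 'rV[R]_n) (f : 'rV[R]_n -> R) : Prop :=
  smooth f /\
  exists K : set 'rV[R]_n, [/\ compact K, K `<=` Omega &
                             forall x, ~ K x -> f x = 0].

Fixpoint iint (m : nat) (F : seq R -> \bar R) : \bar R :=
  match m with
  | 0 => F [::]
  | m'.+1 => (\int[@lebesgue_measure R]_(t in [set: R]) iint m' (fun s => F (t :: s)))%E
  end.

(* Lebesgue integral over R^n (of nonnegative functions, via Tonelli) *)
Definition intRn (n : nat) (f : 'rV[R]_n -> \bar R) : \bar R :=
  iint n (fun s => f (\row_(i < n) nth 0 s i)).

Definition intOn (n : nat) (Omega : set 'rV[R]_n) (f : 'rV[R]_n -> R) : \bar R :=
  intRn (fun x => ((\1_Omega x) * f x)%:E).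

Definition grad_norm2 (n : nat) (u : 'rV[R]_n -> R) (x : 'rV[R]_n) : R :=
  \sum_(i < n) (partial i u x) ^+ 2.

Definition crit_exp (n : nat) : R := (2 * n%:R) / (n%:R - 2).

End Defs.

(* Main.v *)
(* Put g_i = d_i u - u / (2 x_i) for i <= k and g_i = d_i u for i > k. Since
   (d_i u)^2 = g_i^2 + u^2 / (4 x_i^2) + d_i (u^2 / (2 x_i)), the Hardy deficit is
   the sum of the integrals of g_i^2. With q = 2(n-1)/(n-2), the derivative of |u|^q
   in x_i is at least - q |u|^(q-1) |g_i|, so |u|^q is bounded by the integral of
   q |u|^(q-1) |g_i| over each line parallel to the i-th axis. The Loomis-Whitney
   inequality, as in Gagliardo's proof of the Sobolev inequality, and the
   Cauchy-Schwarz inequality, with p = 2(q-1) the critical exponent, give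
   S^(2(n-1)) <= q^(2n) S^n prod_i int g_i^2 for S = int |u|^p, and AM-GM yields
   the theorem with C = n / q^2. *)
Require Import Defs.
From HB Require Import structures.
From mathcomp Require Import all_boot all_order all_algebra.
From mathcomp Require Import all_classical all_reals all_analysis.
From mathcomp Require Import measurable_realfun ring lra zify.
Import Order.TTheory GRing.Theory Num.Theory numFieldNormedType.Exports.
Local Open Scope classical_set_scope.
Local Open Scope ring_scope.

(** * Measurability of iterated integrals *)

Section IteratedIntegral.
Set Implicit Arguments. Unset Strict Implicit. Unset Printing Implicit Defensive.
Variable R : realType.
Local Notation mu := (@lebesgue_measure R).
Implicit Types (F G : seq R -> R) (f g : R -> R) (b : R).

(** The one-sided bound on the derivative of |u|^q comes from u d_i u = u g_i + u^2 / (2 x_i), whose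
    last term is nonnegative on the orthant. A lower bound suffices because each line is followed
    from the given point towards +infinity, beyond the support of u. The exponent q is the only one
    for which p (n - 1) = q n and p = 2 (q - 1) hold together: the first relation is what
    Loomis-Whitney requires, the second what Cauchy-Schwarz requires. Compactness keeps the support
    of u at a positive distance from the walls x_i = 0 with i <= k, so that u / x_i is bounded. The
    integral over R^n is by definition an iterated one-dimensional integral, in a fixed order, of a
    function of lists; Tonelli's theorem, Hölder's inequality and the measurability of the
    integrands are therefore established in that form. *)

Lemma iint_ge0 m (F : seq R -> \bar R) :
  (forall s, size s = m -> (0 <= F s)%E) -> (0 <= iint m F)%E.
Proof.
elim: m F => [|m IH] F F0 /=; first exact: F0.
by apply: integral_ge0 => t _; apply: IH => s sm; apply: F0; rewrite /= sm.
Qed.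

Lemma eq_iint m (F G : seq R -> \bar R) :
  (forall s, size s = m -> F s = G s) -> iint m F = iint m G.
Proof.
elim: m F G => [|m IH] F G FG /=; first exact: FG.
by apply: eq_integral => t _; apply: IH => s sm; apply: FG; rewrite /= sm.
Qed.

(** The induction runs over all parameter spaces at once: the outermost variable is absorbed into
    the parameter, so the induction hypothesis is used for [T * R], and Tonelli's theorem integrates
    that variable out. *)
Lemma measurable_iint d (T : measurableType d) m (G : T -> seq R -> \bar R) :
  (forall y s, size s = m -> (0 <= G y s)%E) ->
  measurable_fun [set: T * m.-tuple R] (fun p => G p.1 p.2) ->
  measurable_fun [set: T] (fun y => iint m (G y)).
Proof.
elim: m d T G => [|m IH] d T G G0 mG /=.
  have -> : (fun y => G y [::]) =
      (fun p : T * 0.-tuple R => G p.1 p.2) \o (fun y => (y, [tuple])) by [].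
  by apply: measurableT_comp mG _; apply: measurable_fun_pair.
apply: (@measurable_fun_fubini_tonelli_F _ _ T (measurableTypeR R) R mu
  (fun p : T * R => iint m (fun s => G p.1 (p.2 :: s)))).
- apply: (IH _ (T * R)%type (fun p s => G p.1 (p.2 :: s))).
    by move=> y s sm; apply: G0; rewrite /= sm.
  have -> : (fun p : (T * R) * m.-tuple R => G p.1.1 (p.1.2 :: p.2)) =
      (fun p : T * m.+1.-tuple R => G p.1 p.2) \o
      (fun p : (T * R) * m.-tuple R => (p.1.1, [tuple of p.1.2 :: p.2])) by [].
  apply: measurableT_comp mG _; apply: measurable_fun_pair.
    by apply: measurableT_comp.
  by apply: measurable_cons => //; apply: measurableT_comp.
- by move=> p; apply: iint_ge0 => s sm; apply: G0; rewrite /= sm.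
Qed.

(** Integrands take lists, as in [iint]; restricting them to [m.-tuple R] supplies the product
    sigma-algebra. *)
Definition tmeasurable m F := measurable_fun [set: m.-tuple R] (fun s : m.-tuple R => F s).

Lemma tmeasurable_nth m j : tmeasurable m (fun s => nth 0 s j).
Proof.
rewrite /tmeasurable; have [jm|mj] := ltnP j m.
  rewrite (_ : (fun _ => _) = (@tnth _ R)^~ (Ordinal jm)) //.
    exact: measurable_tnth.
  by apply/funext => s; rewrite (tnth_nth 0).
rewrite (_ : (fun _ => _) = cst 0) //.
by apply/funext => s; rewrite nth_default // size_tuple.
Qed.

Lemma measurable_seqmap d (T : measurableType d) m (h : T -> seq R) F :
  tmeasurable m F -> (forall y, size (h y) = m) ->
  (forall j, (j < m)%N -> measurable_fun setT (fun y => nth 0 (h y) j)) ->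
  measurable_fun setT (F \o h).
Proof.
move=> mF hm mh.
pose H y := @Tuple m R (h y) (introT eqP (hm y)).
have -> : F \o h = (fun s : m.-tuple R => F s) \o H by [].
apply: measurableT_comp mF _; apply/measurable_fun_tnthP => i.
rewrite (_ : _ \o H = fun y => nth 0 (h y) i); first exact: mh.
by apply/funext => y /=; rewrite (tnth_nth 0).
Qed.

Lemma tmeasurable_comp m p (h : seq R -> seq R) F :
  tmeasurable m F -> (forall s, size s = p -> size (h s) = m) ->
  (forall j, (j < m)%N -> tmeasurable p (fun s => nth 0 (h s) j)) ->
  tmeasurable p (F \o h).
Proof.
move=> mF hm mh.
apply: (@measurable_seqmap _ _ m (fun s : p.-tuple R => h s) F) => // y.
by rewrite hm // size_tuple.
Qed.

Lemma eq_tmeasurable m F G : (forall s, size s = m -> F s = G s) ->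
  tmeasurable m F -> tmeasurable m G.
Proof.
move=> FG; rewrite /tmeasurable (_ : (fun s : m.-tuple R => G s) = (fun s => F s)) //.
by apply/funext => s; rewrite FG // size_tuple.
Qed.

(** * Bounded functions supported in a cube, and their real-valued integrals *)

Definition box b (s : seq R) := all (fun x => `|x| <= b) s.

(* Functions are only constrained on lists of length [m], the points of R^m. All
   integrands below are bounded with support in one fixed cube, so that every
   iterated integral is finite and the estimates can be carried out in [R]. *)
Definition boxed b m F := tmeasurable m F /\
  exists2 M : R, 0 <= M & forall s, size s = m -> 0 <= F s <= M * (box b s)%:R.

Definition boxed1 b f := measurable_fun setT f /\
  exists2 M : R, 0 <= M & forall t, 0 <= f t <= M * (`|t| <= b)%R%:R.

Lemma boxed_ge0 b m F s : boxed b m F -> size s = m -> 0 <= F s.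
Proof. by case=> _ [M _ H] /H /andP[]. Qed.

Lemma eq_boxed b m F G : (forall s, size s = m -> F s = G s) ->
  boxed b m F -> boxed b m G.
Proof.
move=> FG [mF [M M0 FM]]; split; first exact: eq_tmeasurable mF.
by exists M => // s sm; rewrite -FG // FM.
Qed.

(** [fine] sends infinite values to 0; by [iintE] nothing is lost for boxed functions. *)
Definition iterint m F : R := fine (iint m (EFin \o F)).

Lemma eq_iterint m F G : (forall s, size s = m -> F s = G s) -> iterint m F = iterint m G.
Proof. by move=> FG; congr fine; apply: eq_iint => s /FG /= ->. Qed.

Lemma itv_indicE b t : (`|t| <= b)%R%:R = \1_(`[- b, b]%classic : set R) t :> R.
Proof. by rewrite indicE /= mem_setE in_itv /= ler_norml. Qed.

Section Fixed_b.
Variable b : R.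
Hypothesis b0 : 0 <= b.

Lemma integral_box : (\int[mu]_t (`|t| <= b)%R%:R%:E = (2 * b)%:E)%E.
Proof.
under eq_integral => t _ do rewrite itv_indicE.
rewrite integral_indic // setIT /= lebesgue_measure_itv /= lte_fin.
case: ltP => h; first by rewrite -EFinD opprK mulr2n mulrDl mul1r.
have hb : b <= 0 by lra.
have -> : b = 0 by apply/eqP; rewrite eq_le hb.
by rewrite mulr0.
Qed.

Lemma measurable_box : measurable_fun setT (fun t : R => (`|t| <= b)%R%:R : R).
Proof.
rewrite (_ : (fun _ => _) = \1_(`[- b, b]%classic : set R)).
  exact: measurable_indic.
by apply/funext => t; rewrite itv_indicE.
Qed.

Lemma boxed1_integrable f : boxed1 b f -> mu.-integrable setT (EFin \o f).
Proof.
move=> [mf [M M0 fM]].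
apply: (@le_integrable _ _ _ mu _ measurableT _ (fun t => (M * (`|t| <= b)%R%:R)%:E)) => //.
- exact/measurable_EFinP.
- move=> t _ /=; have /andP[h1 h2] := fM t.
  by rewrite lee_fin (ger0_norm h1) ger0_norm // (le_trans h1 h2).
apply/integrableP; split.
  by apply/measurable_EFinP; apply: measurable_funM => //; exact: measurable_box.
under eq_integral => t _ do rewrite /= ger0_norm ?mulr_ge0// EFinM.
rewrite ge0_integralZl_EFin //.
- by rewrite integral_box -EFinM ltry.
- by apply/measurable_EFinP; exact: measurable_box.
Qed.

Lemma boxed1_ge0 f t : boxed1 b f -> 0 <= f t.
Proof. by case=> _ [M _ H]; case/andP: (H t). Qed.

Lemma tmeasurable_section m F t : tmeasurable m.+1 F -> tmeasurable m (fun s => F (t :: s)).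
Proof.
move=> mF; apply: (tmeasurable_comp (h := cons t) mF) => [s /= ->//|[|j] _ /=].
  exact: measurable_cst.
exact: tmeasurable_nth.
Qed.

Lemma boxed_section m F t : boxed b m.+1 F -> boxed b m (fun s => F (t :: s)).
Proof.
move=> [mF [M M0 FM]]; split; first exact: tmeasurable_section.
exists M => // s sm; have /= := FM (t :: s); rewrite sm => /(_ erefl).
move=> /andP[-> h] /=; apply: le_trans h _; apply: ler_wpM2l => //.
by case: (`|t| <= b).
Qed.

Lemma measurable_section_iint m F : (forall s, size s = m.+1 -> 0 <= F s) ->
  tmeasurable m.+1 F ->
  measurable_fun setT (fun t => iint m (EFin \o (fun s => F (t :: s)))).
Proof.
move=> F0 mF; apply: (@measurable_iint _ _ m (fun t s => (F (t :: s))%:E)).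
  by move=> t s sm; rewrite lee_fin F0 //= sm.
apply/measurable_EFinP.
apply: (@measurable_seqmap _ _ m.+1 (fun p : R * m.-tuple R => p.1 :: p.2)) => //.
  by move=> p /=; rewrite size_tuple.
move=> [|j] _ /=; first exact: measurable_fst.
have mj : measurable_fun setT (fun s : m.-tuple R => nth 0 s j) := tmeasurable_nth j.
exact: (measurableT_comp mj measurable_snd).
Qed.

Lemma iint_bound m F M : tmeasurable m F -> 0 <= M ->
  (forall s, size s = m -> 0 <= F s <= M * (box b s)%:R) ->
  (iint m (EFin \o F) <= (M * (2 * b) ^+ m)%:E)%E.
Proof.
elim: m F M => [|m IH] F M mF M0 FM /=.
  by rewrite expr0 lee_fin; have /andP[] := FM [::] erefl.
pose h (t : R) := M * (`|t| <= b)%R%:R * (2 * b) ^+ m.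
have F0 s : size s = m.+1 -> 0 <= F s by move=> /FM /andP[].
have h0 t : 0 <= h t by rewrite /h mulr_ge0 ?exprn_ge0 ?mulr_ge0.
apply: (@le_trans _ _ (\int[mu]_t (h t)%:E)%E).
  apply: ge0_le_integral => //.
  - move=> t _; apply: iint_ge0 => s sm; rewrite lee_fin; apply: F0.
    by rewrite /= sm.
  - exact: measurable_section_iint.
  - apply/measurable_EFinP; apply: measurable_funM => //.
    by apply: measurable_funM => //; exact: measurable_box.
  - move=> t _; apply: IH; [exact: tmeasurable_section|by rewrite mulr_ge0|].
    move=> s sm; have := FM (t :: s); rewrite /= sm => /(_ erefl).
    by rewrite -mulrA -natrM mulnb.
under eq_integral => t _ do rewrite /h mulrAC EFinM.
rewrite ge0_integralZl_EFin //.
- by rewrite integral_box -EFinM lee_fin -[leLHS]mulrA -exprSr.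
- by apply/measurable_EFinP; exact: measurable_box.
- by rewrite mulr_ge0 ?exprn_ge0 ?mulr_ge0.
Qed.

Lemma iintE m F : boxed b m F -> iint m (EFin \o F) = (iterint m F)%:E.
Proof.
move=> nF; have [mF [M M0 FM]] := nF; rewrite /iterint fineK //.
rewrite ge0_fin_numE.
  by apply: le_lt_trans (ltry _); exact: iint_bound FM.
by apply: iint_ge0 => s sm; rewrite lee_fin; exact: boxed_ge0 nF sm.
Qed.

Lemma iterint_ge0 m F : boxed b m F -> 0 <= iterint m F.
Proof.
move=> nF; rewrite -lee_fin -(iintE nF).
by apply: iint_ge0 => s sm; rewrite lee_fin; exact: boxed_ge0 nF sm.
Qed.

Lemma iterintS m F : boxed b m.+1 F ->
  iterint m.+1 F = \int[mu]_t iterint m (fun s => F (t :: s)).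
Proof.
move=> nF; rewrite {1}/iterint /Rintegral /=; congr fine; apply: eq_integral => t _.
by rewrite -(iintE (boxed_section t nF)).
Qed.

Lemma boxed1_iterint m F : boxed b m.+1 F ->
  boxed1 b (fun t => iterint m (fun s => F (t :: s))).
Proof.
move=> nF; have [mF [M M0 FM]] := nF; split.
  apply: measurableT_comp => //.
  by apply: measurable_section_iint => // s sm; exact: boxed_ge0 nF sm.
exists (M * (2 * b) ^+ m); first by rewrite mulr_ge0 ?exprn_ge0 ?mulr_ge0.
move=> t; rewrite iterint_ge0 /=; last exact: boxed_section.
rewrite -lee_fin -(iintE (boxed_section t nF)) mulrAC; apply: iint_bound.
- exact: tmeasurable_section.
- by rewrite mulr_ge0.
move=> s sm; have := FM (t :: s); rewrite /= sm => /(_ erefl).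
by rewrite -mulrA -natrM mulnb.
Qed.

(** Lets results on [boxed b m], such as Hölder's inequality, be applied in the first coordinate
    alone. *)
Lemma boxed1P f : boxed1 b f <-> boxed b 1 (fun s => f (head 0 s)).
Proof.
split=> -[mf [M M0 fM]]; split.
- have mh : tmeasurable 1 (head 0).
    apply: (@eq_tmeasurable _ (fun s => nth 0 s 0)) (@tmeasurable_nth _ _) => s _.
    by rewrite nth0.
  exact: (measurableT_comp mf mh).
- exists M => // -[|t [|]] //= _; rewrite andbT; exact: fM.
- have -> : f = (fun s => f (head 0 s)) \o (fun t => [:: t]) by [].
  apply: (measurable_seqmap mf) => // -[|j] // _.
  exact: measurable_id.
- by exists M => // t; have := fM [:: t] erefl; rewrite /= andbT.
Qed.

Lemma le_iterint m F G : boxed b m F -> boxed b m G ->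
  (forall s, size s = m -> F s <= G s) -> iterint m F <= iterint m G.
Proof.
elim: m F G => [|m IH] F G nF nG FG; first exact: FG.
rewrite !iterintS //; apply: le_Rintegral => //.
- exact: boxed1_integrable (boxed1_iterint nF).
- exact: boxed1_integrable (boxed1_iterint nG).
move=> t _; apply: IH; [exact: boxed_section|exact: boxed_section|].
by move=> s sm; apply: FG; rewrite /= sm.
Qed.

Lemma boxedD m F G : boxed b m F -> boxed b m G -> boxed b m (fun s => F s + G s).
Proof.
move=> [mF [M M0 FM]] [mG [N N0 GN]]; split; first exact: measurable_funD.
exists (M + N) => [|s sm]; first exact: addr_ge0.
have /andP[h1 h2] := FM s sm; have /andP[h3 h4] := GN s sm.
by rewrite addr_ge0 //= mulrDl lerD.
Qed.

Lemma boxedZ m F c : 0 <= c -> boxed b m F -> boxed b m (fun s => c * F s).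
Proof.
move=> c0 [mF [M M0 FM]]; split; first exact: measurable_funM.
exists (c * M) => [|s sm]; first exact: mulr_ge0.
by have /andP[h1 h2] := FM s sm; rewrite mulr_ge0 //= -mulrA ler_wpM2l.
Qed.

Lemma boxedM m F G : boxed b m F -> boxed b m G -> boxed b m (fun s => F s * G s).
Proof.
move=> [mF [M M0 FM]] [mG [N N0 GN]]; split; first exact: measurable_funM.
exists (M * N) => [|s sm]; first exact: mulr_ge0.
have /andP[h1 h2] := FM s sm; have /andP[h3 h4] := GN s sm.
rewrite mulr_ge0 //=; apply: le_trans (ler_pM h1 h3 h2 h4) _.
by case: box; rewrite ?mulr1 ?mulr0.
Qed.

Lemma boxed0 m : boxed b m (fun=> 0).
Proof.
split; first exact: measurable_cst.
by exists 0 => // s _; rewrite mul0r lexx.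
Qed.

Lemma boxed_sum m (I : Type) (r : seq I) (P : pred I) (H : I -> seq R -> R) :
  (forall i, P i -> boxed b m (H i)) -> boxed b m (fun s => \sum_(i <- r | P i) H i s).
Proof.
move=> nH; elim: r => [|i r IH].
  by apply: eq_boxed (boxed0 m) => s _; rewrite big_nil.
have [Pi|nPi] := boolP (P i).
  by apply: eq_boxed (boxedD (nH i Pi) IH) => s _; rewrite big_cons Pi.
by apply: eq_boxed IH => s _; rewrite big_cons (negbTE nPi).
Qed.

Lemma iterintD m F G : boxed b m F -> boxed b m G ->
  iterint m (fun s => F s + G s) = iterint m F + iterint m G.
Proof.
elim: m F G => [|m IH] F G nF nG //.
rewrite !iterintS //; last exact: boxedD.
rewrite -RintegralD //.
- apply: eq_Rintegral => t _; apply: (IH (fun s => F (t :: s))); exact: boxed_section.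
- exact: boxed1_integrable (boxed1_iterint nF).
- exact: boxed1_integrable (boxed1_iterint nG).
Qed.

Lemma iterintZ m F c : 0 <= c -> boxed b m F -> iterint m (fun s => c * F s) = c * iterint m F.
Proof.
move=> c0; elim: m F => [|m IH] F nF //.
rewrite !iterintS //; last exact: boxedZ.
rewrite -RintegralZl //.
- apply: eq_Rintegral => t _; apply: (IH (fun s => F (t :: s))); exact: boxed_section.
- exact: boxed1_integrable (boxed1_iterint nF).
Qed.

Lemma iterint0 m : iterint m (fun=> 0) = 0.
Proof.
rewrite -[RHS](mul0r (iterint m (fun=> 0))) -(iterintZ _ (boxed0 m)) //.
by apply: eq_iterint => s _; rewrite mul0r.
Qed.

Lemma iterint_sum m (I : Type) (r : seq I) (P : pred I) (H : I -> seq R -> R) :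
  (forall i, P i -> boxed b m (H i)) ->
  iterint m (fun s => \sum_(i <- r | P i) H i s) = \sum_(i <- r | P i) iterint m (H i).
Proof.
move=> nH; elim: r => [|i r IH].
  by rewrite big_nil -[RHS](iterint0 m); apply: eq_iterint => s _; rewrite big_nil.
have [Pi|nPi] := boolP (P i).
  rewrite big_cons Pi -IH -iterintD; [|exact: nH|exact: boxed_sum].
  by apply: eq_iterint => s _; rewrite big_cons Pi.
by rewrite big_cons (negbTE nPi) -IH; apply: eq_iterint => s _; rewrite big_cons (negbTE nPi).
Qed.

Lemma boxed_comp m p (h : seq R -> seq R) F : boxed b m F ->
  (forall s, size s = p -> size (h s) = m) ->
  (forall j, (j < m)%N -> tmeasurable p (fun s => nth 0 (h s) j)) ->
  (forall s, size s = p -> box b (h s) -> box b s) ->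
  boxed b p (F \o h).
Proof.
move=> [mF [M M0 FM]] hm mh hb; split; first exact: tmeasurable_comp mF hm mh.
exists M => // s sp; have /andP[-> h2] /= := FM (h s) (hm s sp).
apply: le_trans h2 _; apply: ler_wpM2l => //; rewrite ler_nat.
by case: (box b (h s)) (hb s sp) => // ->.
Qed.

Lemma boxed1_slice m F s : boxed b m.+1 F -> size s = m -> boxed1 b (fun t => F (t :: s)).
Proof.
move=> [mF [M M0 FM]] sm; split.
  apply: (measurable_seqmap (h := fun t => t :: s) mF) => /=; first by rewrite sm.
  by move=> [|j] _ /=; [exact: measurable_id|exact: measurable_cst].
exists M => // t; have := FM (t :: s); rewrite /= sm => /(_ erefl).
move=> /andP[-> h] /=; apply: le_trans h _; apply: ler_wpM2l => //.
by rewrite ler_nat; case: (`|t| <= b); case: box.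
Qed.

Lemma boxed1_Rintegral_le f M : boxed1 b f -> (forall t, f t <= M * (`|t| <= b)%R%:R) ->
  0 <= M -> \int[mu]_t f t <= M * (2 * b).
Proof.
move=> nf fM M0.
have nM : boxed1 b (fun t => M * (`|t| <= b)%R%:R).
  split; first by apply: measurable_funM => //; exact: measurable_box.
  by exists M => // t; rewrite mulr_ge0 /=.
apply: le_trans (le_Rintegral measurableT (boxed1_integrable nf)
  (boxed1_integrable nM) (fun t _ => fM t)) _.
rewrite RintegralZl //.
  by rewrite /Rintegral integral_box.
apply: boxed1_integrable; split; first exact: measurable_box.
by exists 1 => // t; rewrite mul1r lexx andbT.
Qed.

Lemma tmeasurable_int m F : tmeasurable m.+1 F -> (forall s, size s = m.+1 -> 0 <= F s) ->
  tmeasurable m (fun s => \int[mu]_t F (t :: s)).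
Proof.
move=> mF F0; apply: measurableT_comp => //.
apply: (@measurable_fun_fubini_tonelli_F _ _ (m.-tuple R) (measurableTypeR R) R mu
  (fun p : m.-tuple R * R => (F (p.2 :: p.1))%:E)).
- apply/measurable_EFinP.
  apply: (measurable_seqmap (h := fun p : m.-tuple R * R => p.2 :: p.1) mF) => /=.
    by move=> p; rewrite size_tuple.
  move=> [|j] _ /=; first exact: measurable_snd.
  have mj : measurable_fun setT (fun s : m.-tuple R => nth 0 s j) := tmeasurable_nth j.
  exact: (measurableT_comp mj measurable_fst).
- by move=> p; rewrite lee_fin F0 //= size_tuple.
Qed.

Lemma boxed_int m F : boxed b m.+1 F -> boxed b m (fun s => \int[mu]_t F (t :: s)).
Proof.
move=> nF; have [mF [M M0 FM]] := nF; split.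
  by apply: tmeasurable_int => // s; exact: boxed_ge0 nF.
exists (M * (2 * b)) => [|s sm]; first by rewrite !mulr_ge0.
have n1 := boxed1_slice nF sm.
rewrite Rintegral_ge0 /= => [|t _]; last exact: boxed1_ge0 n1.
rewrite mulrAC; apply: boxed1_Rintegral_le => //; last by rewrite mulr_ge0.
move=> t; have := FM (t :: s); rewrite /= sm => /(_ erefl) /andP[_].
by rewrite -mulrA -natrM mulnb andbC.
Qed.

(** * Reordering of iterated integrals, and Hölder's inequality *)

Lemma EFin_Rintegral f : boxed1 b f ->
  ((\int[mu]_t f t)%:E = \int[mu]_t (f t)%:E)%E.
Proof.
move=> nf; rewrite /Rintegral fineK //.
exact: integrable_fin_num (boxed1_integrable nf).
Qed.

(* [iint] integrates the first coordinate outermost; here it becomes innermost. *)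
Lemma iterint_swap m F : boxed b m.+1 F ->
  iterint m.+1 F = iterint m (fun s => \int[mu]_t F (t :: s)).
Proof.
elim: m F => [|m IH] F nF; first by rewrite iterintS.
(* With the second coordinate frozen at [t1], the induction hypothesis moves the first one past all
   the others; the two outermost integrals are then exchanged by Tonelli's theorem. *)
pose F' t1 := fun s : seq R => F (head 0 s :: t1 :: behead s).
have nF' t1 : boxed b m.+1 (F' t1).
  apply: (boxed_comp (h := fun s => head 0 s :: t1 :: behead s) nF).
  - by case=> // a s [/= ->].
  - move=> [|[|j]] _ /=.
    + by apply: eq_tmeasurable (@tmeasurable_nth m.+1 0) => -[].
    + exact: measurable_cst.
    + by apply: eq_tmeasurable (@tmeasurable_nth m.+1 j.+1) => -[] //=; rewrite nth_nil.
  - by case=> // a s _ /= /and3P[-> _ ->].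
pose K t t1 := iterint m (fun s => F [:: t, t1 & s]).
have nK t : boxed1 b (K t) by exact: (boxed1_iterint (boxed_section t nF)).
have nK' t1 : boxed1 b (K^~ t1) by exact: boxed1_iterint (nF' t1).
have -> : iterint m.+2 F = \int[mu]_t \int[mu]_t1 K t t1.
  rewrite iterintS //; apply: eq_Rintegral => t _.
  by rewrite iterintS //; exact: boxed_section.
rewrite iterintS; last exact: boxed_int.
have -> : \int[mu]_t1 iterint m (fun s => \int[mu]_t F [:: t, t1 & s]) =
          \int[mu]_t1 \int[mu]_t K t t1.
  by apply: eq_Rintegral => t1 _; rewrite -(IH _ (nF' t1)) iterintS.
rewrite /Rintegral; congr fine.
under eq_integral => t _ do rewrite EFin_Rintegral //.
under [RHS]eq_integral => t _ do rewrite EFin_Rintegral //.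
apply: (@fubini_tonelli _ _ (measurableTypeR R) (measurableTypeR R) R mu mu
   (fun p => (K p.1 p.2)%:E)); last first.
  by move=> p; rewrite lee_fin; exact: boxed1_ge0 (nK _).
apply/measurable_EFinP.
apply: measurableT_comp => //.
apply: (@measurable_iint _ (measurableTypeR R * measurableTypeR R)%type m
  (fun p s => (F [:: p.1, p.2 & s])%:E)).
  by move=> y s sm; rewrite lee_fin; apply: boxed_ge0 nF _; rewrite /= sm.
apply/measurable_EFinP; case: nF => mF _.
apply: (measurable_seqmap
  (h := fun q : (R * R) * m.-tuple R => [:: q.1.1, q.1.2 & q.2]) mF) => /=.
  by move=> q; rewrite size_tuple.
move=> [|[|j]] _ /=; [by apply: measurableT_comp|by apply: measurableT_comp|].
have mj : measurable_fun setT (fun s : m.-tuple R => nth 0 s j) := tmeasurable_nth j.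
exact: (measurableT_comp mj measurable_snd).
Qed.

Definition ins i (t : R) (s : seq R) := take i s ++ t :: drop i s.

Lemma boxed_ins m F i : boxed b m.+1 F -> (i <= m)%N ->
  boxed b m.+1 (fun s => F (ins i (head 0 s) (behead s))).
Proof.
move=> nF im.
apply: (boxed_comp (h := fun s => ins i (head 0 s) (behead s)) nF) => /=.
- case=> //= a s [sm]; by rewrite /ins size_cat /= addnS -size_cat cat_take_drop sm.
- move=> j jm.
  apply: (@eq_tmeasurable _ (fun s => nth 0 s (if (j < i)%N then j.+1 else
     if j == i then 0%N else j))) (@tmeasurable_nth _ _).
  case=> //= a s [sm]; rewrite /ins nth_cat size_take sm.
  have -> : (if (i < m)%N then i else m) = i by case: ltngtP im.
  case: ltngtP => [ji|ij|->]; rewrite /= ?nth_take ?subnn //.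
  by rewrite -(subnKC ij) addSnnS addKn /= nth_drop addnS.
- case=> //= a s _; rewrite /ins /box all_cat /= => /and3P[h1 -> h3] /=.
  by rewrite -(cat_take_drop i s) all_cat h1.
Qed.

Lemma boxed_int_ins m F i : boxed b m.+1 F -> (i <= m)%N ->
  boxed b m (fun s => \int[mu]_t F (ins i t s)).
Proof. by move=> nF im; exact: boxed_int (boxed_ins nF im). Qed.

(** Any coordinate can be integrated innermost: the outer coordinates are peeled off until the
    chosen one comes first, and [iterint_swap] moves it inwards. *)
Lemma iterint_ins m F i : boxed b m.+1 F -> (i <= m)%N ->
  iterint m.+1 F = iterint m (fun s => \int[mu]_t F (ins i t s)).
Proof.
elim: i m F => [|i IH] m F nF im.
  by rewrite iterint_swap //; apply: eq_iterint => s _; rewrite /ins take0 drop0.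
case: m im nF => // m im nF.
rewrite iterintS // iterintS; last exact: (boxed_int_ins nF).
apply: eq_Rintegral => t _; rewrite (IH _ (fun s => F (t :: s))) //.
exact: boxed_section.
Qed.

(* Hölder's inequality without roots. For [e > 0], the AM-GM inequality applied to
   the [H i s / (iterint m (H i) + e)] gives the bound with [e] added to each
   integral; then [e] tends to 0. *)
Lemma hoelder_iterint m k F (H : nat -> seq R -> R) c : (0 < k)%N -> 0 <= c ->
  boxed b m F -> (forall i, (i < k)%N -> boxed b m (H i)) ->
  (forall s, size s = m -> F s ^+ k <= c * \prod_(i < k) H i s) ->
  iterint m F ^+ k <= c * \prod_(i < k) iterint m (H i).
Proof.
move=> k0 c0 nF nH FH.
have JH0 (i : 'I_k) : 0 <= iterint m (H i) by exact/iterint_ge0/nH.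
have eps e : 0 < e -> iterint m F ^+ k <= c * \prod_(i < k) (iterint m (H i) + e).
  move=> e0; pose d (i : 'I_k) := iterint m (H i) + e.
  have d0 i : 0 < d i by rewrite ltr_wpDl.
  set P := c * _; have P0 : 0 <= P.
    by rewrite mulr_ge0 // prodr_ge0 // => i _; exact: ltW (d0 i).
  (* [D] is the bound wanted for [iterint m F]. The weights below are chosen so that each of the [k]
     terms integrates to at most [D / k]. *)
  pose D := P `^ k%:R^-1.
  have DE : D ^+ k = P.
    by rewrite -powR_mulrn ?powR_ge0 // -powRrM mulVf ?powRr1 // pnatr_eq0 -lt0n.
  rewrite -DE; apply: lerXn2r; rewrite ?nnegrE ?powR_ge0 ?(iterint_ge0 nF) //.
  have FD s : size s = m -> F s <= \sum_(i < k) (D / k%:R / d i) * H i s.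
    move=> sm; have F0 := boxed_ge0 nF sm.
    have H0 (i : 'I_k) : 0 <= H i s / d i.
      apply: divr_ge0; last exact: ltW (d0 i).
      exact: boxed_ge0 (nH i (ltn_ord i)) sm.
    have -> : \sum_(i < k) D / k%:R / d i * H i s =
        D * ((\sum_(i in 'I_k) (H i s / d i)) / k%:R).
      rewrite mulr_suml mulr_sumr; apply: eq_bigr => i _.
      by ring.
    rewrite -(ler_pXn2r k0) ?nnegrE //; last first.
      by rewrite mulr_ge0 ?powR_ge0 // divr_ge0 // sumr_ge0.
    rewrite exprMn DE.
    have PE : P * \prod_(i < k) (H i s / d i) = c * \prod_(i < k) H i s.
      have PdE : P = c * \prod_(i < k) d i by [].
      have d_neq0 : \prod_(i < k) d i != 0 by apply/prodf_neq0 => i _; rewrite gt_eqF.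
      by rewrite PdE big_split /= prodfV; field.
    apply: le_trans (FH s sm) _; rewrite -PE; apply: ler_wpM2l => //.
    have := leif_AGM (A := 'I_k) (E := fun i : 'I_k => H i s / d i) (fun i _ => H0 i).
    by rewrite card_ord => -[].
  have nDH (i : 'I_k) : boxed b m (fun s => (D / k%:R / d i) * H i s).
    apply: boxedZ; last exact: nH.
    by rewrite !divr_ge0 ?powR_ge0 ?(ltW (d0 i)).
  apply: le_trans (le_iterint nF (boxed_sum _ (fun i _ => nDH i)) FD) _.
  rewrite iterint_sum //.
  rewrite [leRHS](_ : D = \sum_(i < k) D / k%:R); last first.
    by rewrite sumr_const card_ord -[RHS]mulr_natr divfK // pnatr_eq0 -lt0n.
  apply: ler_sum => i _; rewrite iterintZ; last exact: nH.
    rewrite mulrAC ler_pdivrMr //. apply: ler_wpM2l.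
      by rewrite divr_ge0 ?powR_ge0.
    by rewrite /d lerDl ltW.
  by rewrite !divr_ge0 ?powR_ge0 ?(ltW (d0 i)).
(* The bound is polynomial in [e], hence continuous at 0. *)
pose p : {poly R} := c%:P * \prod_(i < k) ((iterint m (H i))%:P + 'X).
have pE e : p.[e] = c * \prod_(i < k) (iterint m (H i) + e).
  rewrite hornerM hornerC horner_prod; congr (_ * _).
  by apply: eq_bigr => i _; rewrite hornerD hornerC hornerX.
have -> : c * \prod_(i < k) iterint m (H i) = p.[0].
  by rewrite pE; congr (_ * _); apply: eq_bigr => i _; rewrite addr0.
have cp : p.[e] @[e --> 0^'+] --> p.[0].
  by apply: cvg_at_right_filter; exact: continuous_horner.
apply: (cvgr_to_ge cp).
by near=> e; rewrite pE; apply: eps; near: e; exact: nbhs_right_gt.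
Unshelve. all: by end_near. Qed.

(** * Fibre integrals and the Loomis-Whitney inequality *)

Lemma nth_set_nth_if (s : seq R) i t j :
  nth 0 (set_nth 0 s i t) j = if j == i then t else nth 0 s j.
Proof. by rewrite nth_set_nth /=. Qed.

(** The integral over the line through [s] parallel to the [i]-th axis. It is kept as a function of
    all coordinates, constant in the [i]-th, so that fibre integrals in different directions can be
    multiplied. *)
Definition fiber_int (i : nat) G (s : seq R) := \int[mu]_t G (set_nth 0 s i t).

Lemma size_set_nth_ltn (s : seq R) i t : (i < size s)%N ->
  size (set_nth 0 s i t) = size s.
Proof. by move=> im; rewrite size_set_nth; apply/maxn_idPr. Qed.

Lemma boxed1_fiber m i G s : boxed b m G -> (i < m)%N -> size s = m ->
  boxed1 b (fun t => G (set_nth 0 s i t)).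
Proof.
move=> [mG [M M0 GM]] im sm; split.
  apply: (measurable_seqmap (h := fun t => set_nth 0 s i t) mG) => [t|j _].
    by rewrite size_set_nth_ltn sm.
  under eq_fun do rewrite nth_set_nth_if.
  by case: eqP => _; [exact: measurable_id|exact: measurable_cst].
exists M => // t; have := GM (set_nth 0 s i t).
rewrite size_set_nth_ltn sm // => /(_ erefl) /andP[-> h] /=.
apply: le_trans h _; apply: ler_wpM2l => //; rewrite ler_nat.
case: (boolP (box b _)) => // /(all_nthP 0) /(_ i).
by rewrite size_set_nth_ltn sm // => /(_ im); rewrite nth_set_nth_if eqxx => ->.
Qed.

Lemma tmeasurable_fiber m i G : boxed b m G -> (i < m)%N -> tmeasurable m (fiber_int i G).
Proof.
move=> nG im; have [mG _] := nG.
apply: (@tmeasurable_int m (fun s => G (set_nth 0 (behead s) i (head 0 s)))); last first.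
  case=> //= t s [sm]; apply: boxed_ge0 nG _.
  by rewrite size_set_nth_ltn sm.
apply: (tmeasurable_comp (h := fun s => set_nth 0 (behead s) i (head 0 s)) mG).
  by case=> //= t s [sm]; rewrite size_set_nth_ltn sm.
move=> j jm.
apply: eq_tmeasurable (@tmeasurable_nth m.+1 (if j == i then 0%N else j.+1)).
by case=> //= t s _; rewrite nth_set_nth_if; case: eqP.
Qed.

Lemma fiber_int_ge0 m i G s : boxed b m G -> (i < m)%N -> size s = m ->
  0 <= fiber_int i G s.
Proof.
by move=> nG im sm; apply: Rintegral_ge0 => t _; exact: boxed1_ge0 (boxed1_fiber nG im sm).
Qed.

Lemma fiber_int_le m i G : boxed b m G -> (i < m)%N ->
  exists2 M : R, 0 <= M & forall s, size s = m -> fiber_int i G s <= M.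
Proof.
move=> nG im; have [_ [M M0 GM]] := nG.
exists (M * (2 * b)) => [|s sm]; first by rewrite !mulr_ge0.
have n1 := boxed1_fiber nG im sm.
apply: boxed1_Rintegral_le => // t; have := GM (set_nth 0 s i t).
rewrite size_set_nth_ltn sm // => /(_ erefl) /andP[_ h].
apply: le_trans h _; apply: ler_wpM2l => //; rewrite ler_nat.
case: (boolP (box b _)) => // /(all_nthP 0) /(_ i).
by rewrite size_set_nth_ltn sm // => /(_ im); rewrite nth_set_nth_if eqxx => ->.
Qed.

Lemma tmeasurable_prod m (k : nat) (H : nat -> seq R -> R) :
  (forall i, (i < k)%N -> tmeasurable m (H i)) -> tmeasurable m (fun s => \prod_(i < k) H i s).
Proof.
move=> mH; rewrite /tmeasurable (_ : (fun s : m.-tuple R => _) =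
  (fun s => \prod_(i <- index_enum 'I_k)
     (fun (i : 'I_k) (s : m.-tuple R) => H i s) i s)) //.
by apply: measurable_prod => i _; exact: mH.
Qed.

(* The geometric mean of the fibre integrals; the cut-off by [box] restores the
   bounded support that fibre integrals lack. *)
Definition fiber_mean m (G : nat -> seq R -> R) s :=
  (box b s)%:R * (\prod_(i < m) fiber_int i (G i) s) `^ m.-1%:R^-1.

Lemma tmeasurable_box m : tmeasurable m (fun s => (box b s)%:R).
Proof.
have : tmeasurable m (fun s => \prod_(i < m) (`|nth 0 s i| <= b)%R%:R).
  apply: (@tmeasurable_prod m m (fun i s => (`|nth 0 s i| <= b)%R%:R)) => i _.
  have mi : measurable_fun setT (fun s : m.-tuple R => nth 0 s i) := @tmeasurable_nth m i.
  exact: (measurableT_comp measurable_box mi).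
apply: eq_tmeasurable => s sm; rewrite /box.
have [/(all_nthP 0) h|/allPn[x xs hx]] := boolP (all _ s).
  by rewrite big1 // => i _; rewrite h // sm.
have im : (index x s < m)%N by rewrite -sm index_mem.
by rewrite (bigD1 (Ordinal im)) //= nth_index // (negbTE hx) mul0r.
Qed.

Lemma boxed_fiber_mean m (G : nat -> seq R -> R) :
  (forall i, (i < m)%N -> boxed b m (G i)) -> boxed b m (fiber_mean m G).
Proof.
move=> nG; split.
  apply: measurable_funM; first exact: tmeasurable_box.
  apply: (measurableT_comp (measurable_powR _)).
  apply: (@tmeasurable_prod m m (fun i s => fiber_int i (G i) s)) => i im.
  by apply: tmeasurable_fiber => //; exact: nG.
have /choice[M HM] : forall i : 'I_m, exists M : R,
    0 <= M /\ forall s, size s = m -> fiber_int i (G i) s <= M.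
  by move=> i; have [M M0 HM] := fiber_int_le (nG i (ltn_ord i)) (ltn_ord i); exists M.
exists ((\prod_(i < m) M i) `^ m.-1%:R^-1) => [|s sm]; first exact: powR_ge0.
rewrite mulr_ge0 ?powR_ge0 ///= [leRHS]mulrC; apply: ler_wpM2l => //.
have ge0 (i : 'I_m) : 0 <= fiber_int i (G i) s by apply: fiber_int_ge0 (nG _ _) _ sm.
apply: ge0_ler_powR; rewrite ?nnegrE ?invr_ge0 ?prodr_ge0 //.
  by move=> i _; case: (HM i).
by apply: ler_prod => i _; rewrite ge0 /=; case: (HM i) => _; exact.
Qed.

Lemma iterint_head m F : boxed b m.+1 F ->
  iterint 1 (fun s => iterint m (fun s' => F (head 0 s :: s'))) = iterint m.+1 F.
Proof. by move=> nF; rewrite [RHS]iterintS. Qed.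

(* Induction on the dimension: with the first coordinate fixed, Hölder separates
   the fibre integral along it from the geometric mean of the other ones, to which
   the induction hypothesis applies; Hölder in the first coordinate concludes. *)
Lemma loomis_whitney m F (G : nat -> seq R -> R) :
  boxed b m.+2 F -> (forall i, (i < m.+2)%N -> boxed b m.+2 (G i)) ->
  (forall s, size s = m.+2 ->
     F s ^+ m.+1 <= \prod_(i < m.+2) fiber_int i (G i) s) ->
  iterint m.+2 F ^+ m.+1 <= \prod_(i < m.+2) iterint m.+2 (G i).
Proof.
elim: m F G => [|m IH] F G nF nG FG.
  (* In the plane the fibre integral along the first axis depends on [y] only and the one along the
     second axis on [x] only, so the integral of their product splits. *)
  have nG1 x := boxed_section x (nG 1%N isT).
  have nA := boxed_int (nG 0%N isT).
  have JA0 := iterint_ge0 (nG 0%N isT).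
  rewrite expr1 2!big_ord_recl big_ord0 mulr1 /=.
  rewrite [iterint 2 F]iterintS // [iterint 2 (G 1%N)]iterintS //; last exact: nG.
  have n1 := boxed1_iterint (nG 1%N isT).
  rewrite -RintegralZl //; last exact: boxed1_integrable n1.
  apply: le_Rintegral => //; first exact: boxed1_integrable (boxed1_iterint nF).
    apply: boxed1_integrable; move/boxed1P: n1 => /(boxedZ JA0) n1.
    exact/boxed1P.
  move=> x _; rewrite [iterint 2 (G 0%N)]iterint_swap; last exact: nG.
  rewrite mulrC -iterintZ //; last by apply: iterint_ge0.
  apply: le_iterint => //; first exact: boxed_section.
    by apply: boxedZ nA; apply: iterint_ge0.
  case=> [|y []] // _; have := FG [:: x; y] erefl.
  by rewrite expr1 2!big_ord_recl big_ord0 mulr1 mulrC; apply: le_trans.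
pose G' x i := fun s => G i.+1 (x :: s).
have nG' x i : (i < m.+2)%N -> boxed b m.+2 (G' x i).
  by move=> im; exact: boxed_section (nG i.+1 im).
pose A s := \int[mu]_t G 0%N (t :: s).
have nA : boxed b m.+2 A by exact: boxed_int (nG 0%N isT).
(* The m.+2 factors in Hölder's inequality are [A] once and [P] m.+1 times. The integral of [P] thus
   appears with the exponent m.+1 of the induction hypothesis, which is applied to [P] in place of
   [F]. *)
have step x : iterint m.+2 (fun s => F (x :: s)) ^+ m.+2 <=
    iterint m.+3 (G 0%N) * \prod_(i < m.+2) iterint m.+2 (G' x i).
  pose P := fiber_mean m.+2 (G' x).
  have nP : boxed b m.+2 P by apply: boxed_fiber_mean => i; exact: nG'.
  have PX s : size s = m.+2 ->
      P s ^+ m.+1 = (box b s)%:R * \prod_(i < m.+2) fiber_int i (G' x i) s.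
    move=> sm; rewrite exprMn; congr (_ * _); first by case: box; rewrite ?expr1n ?expr0n.
    rewrite -powR_mulrn ?powR_ge0 // -powRrM mulVf ?powRr1 ?pnatr_eq0 //.
    by apply: prodr_ge0 => i _; apply: (fiber_int_ge0 (nG' x i _)).
  have H i : (i < m.+2)%N -> boxed b m.+2 (if i is 0 then A else P) by case: i.
  have := @hoelder_iterint m.+2 m.+2 (fun s => F (x :: s))
    (fun i => if i is 0 then A else P) 1 isT ler01 (boxed_section x nF) H.
  rewrite !mul1r big_ord_recl /= prodr_const card_ord => hJ.
  rewrite [iterint m.+3 _]iterint_swap; last exact: nG.
  apply: le_trans (hJ _) _ => [s sm|]; last first.
    apply: ler_wpM2l; first exact: iterint_ge0.
    apply: IH => // [i|s sm]; first exact: nG'.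
    rewrite PX // ler_piMl //; last by case: box.
    by apply: prodr_ge0 => i _; apply: (fiber_int_ge0 (nG' x i _)).
  rewrite big_ord_recl /= prodr_const card_ord PX //.
  have [bs|nbs] := boolP (box b s).
    rewrite !mul1r; have := FG (x :: s); rewrite /= sm => /(_ erefl).
    by rewrite big_ord_recl.
  (* Outside the cube [P] is cut off to 0, but [F] vanishes there as well. *)
  have [_ [M M0 FM]] := nF.
  have := FM (x :: s); rewrite /= sm => /(_ erefl).
  rewrite (negbTE nbs) andbF !mul0r !mulr0 => F0.
  have -> : F (x :: s) = 0 by apply/le_anti; rewrite andbC.
  by rewrite expr0n.
rewrite big_ord_recl /=.
(* Hölder in the first coordinate: the integral of [G 0] does not depend on it and serves as the
   constant [c]. *)
have := @hoelder_iterint 1 m.+2 (fun s => iterint m.+2 (fun s' => F (head 0 s :: s')))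
  (fun i s => iterint m.+2 (G' (head 0 s) i)) (iterint m.+3 (G 0%N)) isT
  (iterint_ge0 (nG 0%N isT)).
rewrite iterint_head // => hJ; apply: le_trans (hJ _ _ _) _.
- exact: (boxed1P _).1 (boxed1_iterint nF).
- by move=> i im; exact: (boxed1P _).1 (boxed1_iterint (nG i.+1 im)).
- by case=> [|x []] // _; exact: step.
- apply: ler_wpM2l; first exact: iterint_ge0 (nG 0%N isT).
  rewrite le_eqVlt; apply/orP; left; apply/eqP; apply: eq_bigr => i _.
  exact: (iterint_head (nG i.+1 (ltn_ord i))).
Qed.

End Fixed_b.
End IteratedIntegral.

(** * Calculus on a line: powers, the Hardy identity and the Gagliardo bound *)

Section OneVariable.
Set Implicit Arguments. Unset Strict Implicit. Unset Printing Implicit Defensive.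
Variable R : realType.
Local Notation mu := (@lebesgue_measure R).
Implicit Types (f g : R -> R) (a b q r t x : R).

Lemma is_derive_continuous f df x : is_derive x 1 f df -> {for x, continuous f}.
Proof.
move=> h; apply/differentiable_continuous/derivable1_diffP.
exact: ex_derive.
Qed.

Lemma Rintegral_derive f f' x y : x < y ->
  (forall t, x <= t <= y -> is_derive t 1 f (f' t)) ->
  (forall t, x <= t <= y -> {for t, continuous f'}) ->
  \int[mu]_(t in `[x, y]) f' t = f y - f x.
Proof.
move=> xy df cf; rewrite /Rintegral (continuous_FTC2 xy (F := f)) //.
- apply: continuous_in_subspaceT => t; rewrite inE /= in_itv /=; exact: cf.
- split.
  + by move=> t; rewrite in_itv /= => /andP[h1 h2]; apply: ex_derive; apply: df; rewrite !ltW.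
  + by apply: cvg_at_right_filter; apply: is_derive_continuous (df x _); rewrite lexx ltW.
  + by apply: cvg_at_left_filter; apply: is_derive_continuous (df y _); rewrite lexx ltW.
- move=> t; rewrite in_itv /= => /andP[h1 h2]; rewrite derive1E.
  by apply: derive_val; apply: df; rewrite !ltW.
Qed.

Lemma integrable_itv f x y : (forall t, x <= t <= y -> {for t, continuous f}) ->
  mu.-integrable `[x, y] (EFin \o f).
Proof.
move=> cf; apply: continuous_compact_integrable; first exact: segment_compact.
apply: continuous_in_subspaceT => t; rewrite inE /= in_itv /=; exact: cf.
Qed.

(** This is |x|^(2r). Away from 0 the base is positive and [powR] is differentiable there; at 0 the
    one-sided limit of y^r is composed with the square. *)
Lemma continuous_powR_sqr r : 0 < r -> continuous (fun x : R => (x ^+ 2) `^ r).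
Proof.
move=> r0 x; have [->|x0] := eqVneq x 0; last first.
  have x2 : 0 < x ^+ 2 by rewrite exprn_even_gt0.
  apply: (@continuous_comp _ _ _ (fun x => x ^+ 2) (fun y => y `^ r)).
    exact: exprn_continuous.
  exact: is_derive_continuous (is_derive1_powR r x2).
rewrite /continuous_at expr0n powR0 ?gt_eqF //.
apply/cvgrPdist_lt => e e0.
have /cvgrPdist_lt/(_ e e0) := powR_cvg0 r0.
move=> [d /= d0 hd].
near=> y; rewrite sub0r normrN.
have [->|y0] := eqVneq y 0; first by rewrite expr0n powR0 ?gt_eqF // normr0.
have y2 : 0 < y ^+ 2 by rewrite exprn_even_gt0.
have := hd (y ^+ 2); rewrite /ball_ /= !sub0r !normrN (gtr0_norm y2); apply => //.
near: y.
have : (y : R) ^+ 2 @[y --> (0 : R)] --> (0 : R) ^+ 2 by exact: exprn_continuous.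
rewrite expr0n => /cvgrPdist_lt/(_ d d0); apply: filterS => y.
by rewrite sub0r normrN normrX real_normK ?num_real.
Unshelve. all: by end_near. Qed.

(** This is |x|^(2r+2). At 0 the difference quotient is h (h^2)^r, which tends to 0. Hence |u|^q is
    differentiable at the zeros of u too, and the fundamental theorem applies along whole lines. *)
Lemma is_derive_powR_sqr r x : 0 < r ->
  is_derive x 1 (fun x : R => (x ^+ 2) `^ (r + 1)) ((r + 1) * 2 * x * (x ^+ 2) `^ r).
Proof.
move=> r0; have [->|x0] := eqVneq x 0; last first.
  have x2 : 0 < x ^+ 2 by rewrite exprn_even_gt0.
  have h1 := is_derive1_powR (r + 1) x2.
  have h2 : is_derive x 1 (fun x : R => x ^+ 2) (2 * x).
    have := @is_deriveX _ _ id 2 x 1 1 _.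
    by move=> h; apply: (is_derive_eq (h _)); rewrite /= expr1 [LHS]mulr1.
  have h3 := @is_derive1_comp R (fun y : R => y `^ (r + 1)) (fun x : R => x ^+ 2) x _ _ h1 h2.
  apply: (is_derive_eq h3).
  by rewrite addrK; ring.
rewrite mulr0 mul0r.
have cvg0 :
    h^-1 *: (((h *: 1 + 0) ^+ 2) `^ (r + 1) - (0 ^+ 2) `^ (r + 1)) @[h --> (0:R)^'] --> (0:R).
  apply: (@cvg_trans _ ((h : R) * (h ^+ 2) `^ r @[h --> (0:R)^'])).
    apply: near_eq_cvg; near=> h.
    have h0 : h != 0 by near: h; exact: nbhs_dnbhs_neq.
    rewrite addr0 expr0n (powR0 (x := r + 1)) ?gt_eqF ?addr_gt0 // subr0.
    rewrite /GRing.scale /= mulr1 powRD ?powRr1 ?sqr_ge0 //; last first.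
      by rewrite expf_neq0 // implybT.
    by field.
  apply: cvg_within_filter.
  have : h * (h ^+ 2) `^ r @[h --> (0:R)] --> (0:R) * (0 ^+ 2) `^ r.
    by apply: cvgM; [exact: cvg_id|exact: continuous_powR_sqr].
  by rewrite mul0r.
split; first by apply/cvg_ex; exists 0; exact: cvg0.
exact: (cvg_lim (@Rhausdorff R) cvg0).
Unshelve. all: by end_near. Qed.

Lemma powR_sqr_norm x q : (x ^+ 2) `^ (q / 2) = `|x| `^ q.
Proof.
rewrite -real_normK ?num_real // -powR_mulrn // -powRrM; congr (_ `^ _).
by field.
Qed.

Lemma le_Rintegral_setT f (D : set R) : measurable D -> (forall t, 0 <= f t) ->
  mu.-integrable setT (EFin \o f) -> \int[mu]_(t in D) f t <= \int[mu]_t f t.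
Proof.
move=> mD f0 intf; apply: fine_le.
- by apply: integrable_fin_num => //; exact: integrableS intf.
- exact: integrable_fin_num.
- apply: ge0_subset_integral => //; last by move=> t _; rewrite lee_fin.
  by have /integrableP[] := intf.
Qed.

(* For the application [g x = f' x - f x / (2 * x)] on [x > 0]. Integrating from [t]
   to infinity gives the Hardy term the favourable sign, so it can be dropped. *)
Lemma powR_le_Rintegral f f' g r c t : 0 < r ->
  (forall x, is_derive x 1 f (f' x)) -> continuous f' ->
  (forall x, c <= x -> f x = 0) -> (forall x, 0 <= f x * (f' x - g x)) ->
  mu.-integrable setT
    (EFin \o (fun x => (r + 1) * 2 * (`|f x| `^ (2 * r + 1) * `|g x|))) ->
  (f t ^+ 2) `^ (r + 1) <=
    \int[mu]_x ((r + 1) * 2 * (`|f x| `^ (2 * r + 1) * `|g x|)).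
Proof.
move=> r0 df cf' fc fg; set w := (X in EFin \o X) => intw.
have w0 x : 0 <= w x by rewrite /w !mulr_ge0 ?powR_ge0 // addr_ge0 // ltW.
have cf : continuous f by move=> x; exact: is_derive_continuous (df x).
(* A point beyond the support and strictly to the right of [t], so that the interval is not
   degenerate. *)
pose y := Num.max c (t + 1).
have ty : t < y by rewrite lt_max orbC ltrDl ltr01.
have fy : f y = 0 by apply: fc; rewrite le_max lexx.
pose dP x := (r + 1) * 2 * f x * (f x ^+ 2) `^ r * f' x.
have dPE x : is_derive x 1 (fun x => (f x ^+ 2) `^ (r + 1)) (dP x).
  have h1 := is_derive_powR_sqr (f x) r0.
  exact: (@is_derive1_comp R (fun z : R => (z ^+ 2) `^ (r + 1)) f x _ _ h1 (df x)).
have cdP : continuous dP.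
  move=> x; apply: cvgM; last exact: cf'.
  apply: cvgM; first by apply: cvgM; [exact: cvg_cst|exact: cf].
  apply: (@continuous_comp _ _ _ f (fun z => (z ^+ 2) `^ r)); first exact: cf.
  exact: continuous_powR_sqr.
have := @Rintegral_derive _ dP t y ty (fun x _ => dPE x) (fun x _ => cdP x).
rewrite fy expr0n powR0 ?gt_eqF ?addr_gt0 // sub0r => /(congr1 -%R).
rewrite opprK => <-.
apply: le_trans (le_Rintegral_setT (D := `[t, y]%classic) _ w0 intw) => //.
have iP : mu.-integrable `[t, y] (EFin \o dP) by apply: integrable_itv => x _; exact: cdP.
have -> : - (\int[mu]_(x in `[t, y]) dP x) = \int[mu]_(x in `[t, y]) (-1 * dP x).
  by rewrite RintegralZl // mulN1r.
apply: le_Rintegral => //.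
- apply: integrable_itv => x _; apply: cvgM; [exact: cvg_cst|exact: cdP].
- exact: integrableS intw.
move=> x _; rewrite /dP /w.
have -> : (f x ^+ 2) `^ r = `|f x| `^ (2 * r).
  by rewrite -powR_sqr_norm; congr (_ `^ _); field.
have r1 : 0 < 2 * r + 1 by lra.
rewrite -(mulr_powRB1 (normr_ge0 (f x)) r1) addrK.
set P := _ `^ _; have P0 : 0 <= P by exact: powR_ge0.
(* Splits - f f' into - f (f' - g), which is nonpositive by hypothesis, and - f g, which is at most
   |f| |g|. *)
have -> : -1 * ((r + 1) * 2 * f x * P * f' x) =
    (r + 1) * 2 * P * (- (f x * (f' x - g x)) - f x * g x) by ring.
have -> : (r + 1) * 2 * (`|f x| * P * `|g x|) = (r + 1) * 2 * P * (`|f x| * `|g x|) by ring.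
apply: ler_wpM2l; first by rewrite !mulr_ge0 // addr_ge0 // ltW.
rewrite -normrM; have := fg x; have := ler_norm (- (f x * g x)); rewrite normrN.
by move: (f x * g x) (f x * _) `|_| => A B C; lra.
Qed.

Lemma Rintegral_support f (D : set R) : (forall t, ~ D t -> f t = 0) ->
  \int[mu]_t f t = \int[mu]_(t in D) f t.
Proof.
move=> fD; rewrite [RHS]Rintegral_mkcond; apply: eq_Rintegral => t _.
rewrite patchE; case: ifPn => // /negP; rewrite inE => h; exact: fD.
Qed.

(* [p - q] is the derivative of [f x ^+ 2 / (2 * x)]. *)
Lemma hardy_identity f f' a c : 0 < a -> a <= c ->
  (forall x, is_derive x 1 f (f' x)) -> continuous f' ->
  (forall x, ~~ (a <= x <= c) -> f x = 0 /\ f' x = 0) ->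
  let p x := f' x ^+ 2 in
  let q x := (f' x - f x / (2 * x)) ^+ 2 + 4^-1 * ((x ^+ 2)^-1 * f x ^+ 2) in
  mu.-integrable setT (EFin \o p) -> mu.-integrable setT (EFin \o q) ->
  \int[mu]_x p x = \int[mu]_x q x.
Proof.
move=> a0 ac df cf' f0 p q ip iq.
have cf : continuous f by move=> x; exact: is_derive_continuous (df x).
(* The interval is strictly larger than [a, c], so that [f] vanishes at both ends, and still avoids
   the singularity at 0. *)
pose x0 := a / 2; pose y0 := c + 1.
have xy : x0 < y0 by rewrite /x0 /y0; lra.
have out x : ~ `[x0, y0]%classic x -> f x = 0 /\ f' x = 0.
  move=> h; apply: f0; apply/negP => /andP[h1 h2]; apply: h.
  by rewrite /= in_itv /= /x0 /y0; apply/andP; split; lra.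
rewrite (@Rintegral_support p `[x0, y0]%classic); last first.
  by move=> x /out[_ h]; rewrite /p h expr0n.
rewrite (@Rintegral_support q `[x0, y0]%classic); last first.
  by move=> x /out[h1 h2]; rewrite /q h1 h2 mul0r subrr expr0n !mulr0 addr0.
apply/eqP; rewrite -subr_eq0 -RintegralB //; last 2 first.
- exact: integrableS ip.
- exact: integrableS iq.
pose H x := f x * f x * (2^-1 * x^-1).
pose H' x := f x * f' x * x^-1 - 2^-1 * (f x * f x) * (x^-1 * x^-1).
have pos x : x0 <= x <= y0 -> x != 0.
  by move=> /andP[h _]; apply: lt0r_neq0; apply: lt_le_trans h; rewrite /x0; lra.
have dH x : x0 <= x <= y0 -> is_derive x 1 H (H' x).
  move=> /pos x_neq0; have dV := @is_deriveV R id x 1 1 x_neq0 (is_derive_id x 1).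
  have dff := is_deriveM (df x) (df x).
  have dZ := is_deriveZ 2^-1 dV.
  apply: (is_derive_eq (is_deriveM dff dZ)).
  rewrite /H' /=.
  change (f x * f x * (2^-1 * (- x ^- 2 * 1)) + 2^-1 * x^-1 * (f x * f' x + f x * f' x)
    = f x * f' x * x^-1 - 2^-1 * (f x * f x) * (x^-1 * x^-1)).
  by field.
have cH x : x0 <= x <= y0 -> {for x, continuous H'}.
  move=> /pos x_neq0.
  have cV : {for x, continuous (fun x : R => x^-1)} by exact: inv_continuous.
  apply: cvgB.
    by apply: cvgM; [apply: cvgM; [exact: cf|exact: cf']|exact: cV].
  apply: cvgM; last by apply: cvgM; exact: cV.
  by apply: cvgM; [exact: cvg_cst|apply: cvgM; exact: cf].
have -> : \int[mu]_(x in `[x0, y0]) (p x - q x) = \int[mu]_(x in `[x0, y0]) H' x.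
  apply: eq_Rintegral => x; rewrite inE /= in_itv /= => /pos x_neq0.
  by rewrite /= /p /q /H'; field.
rewrite (Rintegral_derive xy dH cH).
have [fy _] : f y0 = 0 /\ f' y0 = 0.
  by apply: f0; rewrite negb_and -!ltNge; apply/orP; right; rewrite /y0; lra.
have [fx _] : f x0 = 0 /\ f' x0 = 0.
  by apply: f0; rewrite negb_and -!ltNge; apply/orP; left; rewrite /x0; lra.
by rewrite /H fx fy !mul0r subrr.
Qed.
End OneVariable.

(** * Row vectors: measurability, restriction to lines, compact supports *)

Section RowVectors.
Set Implicit Arguments. Unset Strict Implicit. Unset Printing Implicit Defensive.
Variable R : realType.
Local Notation mu := (@lebesgue_measure R).

Definition row_of n (s : seq R) : 'rV[R]_n := \row_(i < n) nth 0 s i.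

(** Relates the topology of row vectors to the sigma-algebra of tuples: an open set is a countable
    union of cubes with rational centres and radii 1/(k+1), and a cube is a finite intersection of
    conditions on single coordinates. *)
Lemma open_row_measurable n (U : set 'rV[R]_n) : open U ->
  measurable [set s : n.-tuple R | U (row_of n s)].
Proof.
move=> oU.
pose rad k : R := k.+1%:R^-1.
have rad0 k : 0 < rad k by rewrite invr_gt0.
pose cube (p : n.-tuple rat * nat) (x : 'rV[R]_n) :=
  forall i : 'I_n, `|x ord0 i - ratr (tnth p.1 i)| < rad p.2.
pose good p := cube p `<=` U.
have -> : [set s : n.-tuple R | U (row_of n s)] =
    \bigcup_p (if `[< good p >] then [set s : n.-tuple R | cube p (row_of n s)] else set0).
  apply/seteqP; split => [s /= Us|s [p _]]; last first.
    by case: ifPn => // /asboolP h /h.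
  have /nbhs_ballP[e /= e0 he] : nbhs (row_of n s) U by exact: open_nbhs_nbhs.
  (* Half of [e], because the given point and any other point of the cube are each within [rad k] of
     the rational centre. *)
  have [k hk] : exists k, rad k < e / 2.
    have [N _ hN] := near_infty_natSinv_lt (PosNum (divr_gt0 e0 (ltr0n R 2))).
    by exists N; apply: hN => /=.
  have /choice[q hq] : forall i : 'I_n, exists q : rat, `|nth 0 s i - ratr q| < rad k.
    move=> i.
    have h : nth 0 s i - rad k < nth 0 s i + rad k by have := rad0 k; lra.
    have [q] := rat_in_itvoo h; rewrite in_itv /= => /andP[h1 h2].
    by exists q; rewrite ltr_norml; apply/andP; split; lra.
  exists ([tuple q i | i < n], k) => //.
  rewrite ifT; last first.
    apply/asboolP => x hx; apply: he; split => // i0 j; rewrite ord1 mxE /ball /=.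
    have := hx j; have := hq j; rewrite /= tnth_mktuple !ltr_norml.
    by move=> /andP[h1 h2] /andP[h3 h4]; apply/andP; split; lra.
  by move=> i; rewrite !mxE tnth_mktuple.
apply: countable_bigcupT_measurable => [|p]; first exact: countableP.
case: ifP => _ //.
rewrite (_ : [set s : n.-tuple R | _] =
   \bigcap_(i in [set: 'I_n]) [set s : n.-tuple R | `|nth 0 s i - ratr (tnth p.1 i)| < rad p.2]).
  apply: fin_bigcap_measurable => // i _.
  have mi : measurable_fun setT (fun s : n.-tuple R => nth 0 s i) := @tmeasurable_nth R n i.
  have mf : measurable_fun setT (fun s : n.-tuple R => `|nth 0 s i - ratr (tnth p.1 i)|).
    by apply: measurableT_comp => //; apply: measurable_funB.
  rewrite (_ : [set s : n.-tuple R | _] = [set: n.-tuple R] `&`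
    (fun s : n.-tuple R => `|nth 0 s i - ratr (tnth p.1 i)|) @^-1` `]-oo, rad p.2[%classic).
    exact: mf.
  by rewrite setTI; apply/seteqP; split => s /=; rewrite in_itv.
apply/seteqP; split => [s h i _ /=|s h i].
  by have := h i; rewrite mxE.
by rewrite mxE; exact: (h i I).
Qed.

Lemma tmeasurable_continuous n (f : 'rV[R]_n -> R) : continuous f ->
  tmeasurable n (fun s => f (row_of n s)).
Proof.
move=> cf; apply: (measurability _ (RGenOInfty.measurableE R)) => /=.
move=> _ [_ [a ->]] <-; rewrite setTI.
rewrite (_ : _ @^-1` _ = [set s : n.-tuple R | (f @^-1` `]a, +oo[%classic) (row_of n s)]) //.
apply: open_row_measurable; apply: open_comp; last exact: rray_open.
by move=> x _; exact: cf.
Qed.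

Definition line n (p : 'rV[R]_n) (i : 'I_n) (t : R) := p + t *: delta_mx ord0 i.

Lemma continuous_line n (f : 'rV[R]_n -> R) (p : 'rV[R]_n) (i : 'I_n) : continuous f ->
  continuous (fun t => f (line p i t)).
Proof.
move=> cf t; apply: (@continuous_comp _ _ _ (line p i) f); last exact: cf.
apply: cvgD; first exact: cvg_cst.
by apply: cvgZr_tmp; exact: cvg_id.
Qed.

Lemma is_derive_line n (f : 'rV[R]_n -> R) (p : 'rV[R]_n) (i : 'I_n) (t : R) :
  (forall x, differentiable f x) ->
  is_derive t (1 : R) (fun t : R => f (line p i t)) (partial i f (line p i t)).
Proof.
move=> df.
have E : (fun h : R => h^-1 *: (((fun t : R => f (line p i t)) \o shift t)
    (h *: (1 : R)) - f (line p i t)))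
    = (fun h : R => h^-1 *: ((f \o shift (line p i t)) (h *: delta_mx ord0 i) - f (line p i t))).
  apply/funext => h /=; congr (_ *: (f _ - _)).
  by rewrite /line scalerDl addrCA -[h *: 1]/(h * 1) mulr1.
have d := diff_derivable (v := delta_mx ord0 i) (df (line p i t)).
split; first by rewrite /derivable E.
by rewrite /derive E.
Qed.

(** Turns a fibre of lists into a line of row vectors. The base point has its [i]-th coordinate
    reset to 0, so the parameter is the coordinate itself. *)
Lemma row_of_set_nth n (s : seq R) (i : 'I_n) t : size s = n ->
  row_of n (set_nth 0 s i t) = line (row_of n (set_nth 0 s i 0)) i t.
Proof.
move=> sn; apply/rowP => j; rewrite !mxE !nth_set_nth_if eqxx /= -val_eqE /=.
by case: eqP => _; rewrite ?mulr1 ?add0r // mulr0 addr0.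
Qed.

(** The image of [K] under the coordinate is closed and misses 0, hence misses a ball around 0; an
    empty [K] is covered as well. *)
Lemma compact_coord_gt0 n (K : set 'rV[R]_n) (i : 'I_n) : compact K ->
  (forall x, K x -> 0 < x ord0 i) ->
  exists2 e : R, 0 < e & forall x, K x -> e <= x ord0 i.
Proof.
move=> cK K0.
pose c (x : 'rV[R]_n) := x ord0 i.
have cI : compact (c @` K).
  by apply: continuous_compact => //; apply: continuous_subspaceT; exact: coord_continuous.
have nI : ~ (c @` K) 0 by move=> [x /K0 + x0]; rewrite -/(c x) x0 ltxx.
have := compact_closed (@Rhausdorff R) cI.
rewrite closedE => h; have [e /= e0 he] : nbhs (0 : R) (~` (c @` K)).
  by apply: contrapT => h2; apply: nI; apply: h.
exists e => // x Kx; rewrite leNgt; apply/negP => xe.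
apply: (he (c x)); last by exists x.
by rewrite /ball_ /= sub0r normrN gtr0_norm //; exact: K0.
Qed.

Lemma compact_coord_bounded n (K : set 'rV[R]_n) : compact K ->
  exists2 b : R, 0 <= b & forall x, K x -> forall i, `|x ord0 i| <= b.
Proof.
move=> cK; have /choice[b hb] : forall i : 'I_n, exists b : R, 0 <= b /\
    forall x, K x -> `|x ord0 i| <= b.
  move=> i; pose c (x : 'rV[R]_n) := x ord0 i.
  have cI : compact (c @` K).
    by apply: continuous_compact => //; apply: continuous_subspaceT; exact: coord_continuous.
  have [M [_ hM]] := compact_bounded cI.
  exists (`|M| + 1); split => [|x Kx]; first exact: addr_ge0.
  by apply: (hM (`|M| + 1)); [rewrite ltr_pwDr // ler_norm|exists x].
exists (\sum_i b i) => [|x Kx i]; first by apply: sumr_ge0 => i _; case: (hb i).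
rewrite (bigD1 i) //= ler_wpDr //; last by case: (hb i) => _; apply.
by apply: sumr_ge0 => j _; case: (hb j).
Qed.

Lemma compact_continuous_bounded n (K : set 'rV[R]_n) (f : 'rV[R]_n -> R) :
  compact K -> continuous f -> exists2 M : R, 0 <= M & forall x, K x -> `|f x| <= M.
Proof.
move=> cK cf; have cI : compact (f @` K).
  by apply: continuous_compact => //; exact: continuous_subspaceT.
have [M [_ hM]] := compact_bounded cI.
exists (`|M| + 1) => [|x Kx]; first exact: addr_ge0.
by apply: (hM (`|M| + 1)); [rewrite ltr_pwDr // ler_norm|exists x].
Qed.

Lemma partial_eq0 n (K : set 'rV[R]_n) (f : 'rV[R]_n -> R) i x : compact K ->
  (forall y, ~ K y -> f y = 0) -> ~ K x -> partial i f x = 0.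
Proof.
move=> cK f0 Kx.
have oK : open (~` K) by rewrite openC; apply: compact_closed => //; exact: norm_hausdorff.
rewrite /partial (@near_eq_derive _ _ _ f (cst 0)); first exact: derive_cst.
have : nbhs x (~` K) by apply: open_nbhs_nbhs.
by apply: filterS => y /f0.
Qed.

End RowVectors.

(** * Signed integrands, and the arithmetic of the final inequality *)

Section HardySobolev.
Set Implicit Arguments. Unset Strict Implicit. Unset Printing Implicit Defensive.
Variable R : realType.
Local Notation mu := (@lebesgue_measure R).

(** The signed counterpart of [boxed]; measurability is required separately because that of |F| does
    not imply that of F. *)
Definition sboxed b n (F : seq R -> R) := tmeasurable n F /\ boxed b n (fun s => `|F s|).

Lemma sboxedP b n (F : seq R -> R) M : tmeasurable n F -> 0 <= M ->
  (forall s, size s = n -> `|F s| <= M * (box b s)%:R) -> sboxed b n F.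
Proof.
move=> mF M0 FM; split=> //; split; first exact: measurableT_comp.
by exists M => // s sn; rewrite normr_ge0 FM.
Qed.

Lemma sboxed_bound b n (F : seq R -> R) : sboxed b n F ->
  exists2 M : R, 0 <= M & forall s, size s = n -> `|F s| <= M * (box b s)%:R.
Proof.
move=> [_ [_ [M M0 h]]]; exists M => // s sn.
by have /andP[] := h s sn.
Qed.

Lemma boxed_sqr b n (F : seq R -> R) : sboxed b n F -> boxed b n (fun s => F s ^+ 2).
Proof.
move=> [_ nF]; apply: eq_boxed (boxedM nF nF) => s _.
by rewrite -expr2 real_normK ?num_real.
Qed.

Lemma sboxedB b n (F G : seq R -> R) : sboxed b n F -> sboxed b n G ->
  sboxed b n (fun s => F s - G s).
Proof.
move=> sF sG; have [M M0 FM] := sboxed_bound sF; have [N N0 GN] := sboxed_bound sG.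
apply: (@sboxedP _ _ _ (M + N)); last 2 first.
- exact: addr_ge0.
- move=> s sn; rewrite mulrDl; apply: le_trans (ler_normB _ _) _.
  by apply: lerD; [exact: FM|exact: GN].
by apply: measurable_funB; [case: sF|case: sG].
Qed.

Lemma sboxedZ b n (F : seq R -> R) c : sboxed b n F -> sboxed b n (fun s => c * F s).
Proof.
move=> sF; have [M M0 FM] := sboxed_bound sF.
apply: (@sboxedP _ _ _ (`|c| * M)); last 2 first.
- exact: mulr_ge0.
- by move=> s sn; rewrite normrM -mulrA; apply: ler_wpM2l => //; exact: FM.
by apply: measurable_funM => //; case: sF.
Qed.

Lemma boxed_powR b n (F : seq R -> R) r : 0 < r -> boxed b n F ->
  boxed b n (fun s => F s `^ r).
Proof.
move=> r0 nF; have [mF [M M0 FM]] := nF; split.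
  exact: (measurableT_comp (measurable_powR r) mF).
exists (M `^ r) => [|s sn]; first exact: powR_ge0.
have /andP[F0 h] := FM s sn; rewrite powR_ge0 /=.
have -> : (box b s)%:R = (box b s)%:R `^ r :> R.
  by case: box; rewrite ?powR1 // powR0 // gt_eqF.
rewrite -powRM //; apply: ge0_ler_powR; rewrite ?nnegrE ?mulr_ge0 //.
exact: ltW.
Qed.

Lemma cauchy_schwarz_iterint b n (F G H : seq R -> R) c : 0 <= b -> 0 <= c ->
  boxed b n F -> boxed b n G -> boxed b n H ->
  (forall s, size s = n -> F s ^+ 2 <= c * (G s * H s)) ->
  iterint n F ^+ 2 <= c * (iterint n G * iterint n H).
Proof.
move=> b0 c0 nF boxed_G nH FGH.
pose h j := if j is 0%N then G else H.
have prod2 (f : 'I_2 -> R) : \prod_(i < 2) f i = f ord0 * f (lift ord0 ord0).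
  by rewrite 2!big_ord_recl big_ord0 mulr1.
have := @hoelder_iterint R b b0 n 2 F h c isT c0 nF.
rewrite prod2; apply; first by case.
by move=> s sn; rewrite prod2; exact: FGH.
Qed.

(** With n = m + 3, the n-th power of the left side is x^(n-2); multiplied by x^n it becomes the
    left side of the hypothesis. The factor x^n cancels for x > 0 and AM-GM bounds the product of
    the [a i]; for x = 0 the left side is 0. *)
Lemma geometric_arithmetic_bound m (x y : R) (a : 'I_m.+3 -> R) :
  0 <= x -> 0 <= y -> (forall i, 0 <= a i) ->
  (x ^+ m.+2) ^+ 2 <= \prod_i (y * (x * a i)) ->
  x `^ (m.+1%:R / m.+3%:R) <= y / m.+3%:R * \sum_i a i.
Proof.
move=> x0 y0 a0 xa.
have R0 : 0 <= y / m.+3%:R * \sum_i a i.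
  by rewrite mulr_ge0 ?divr_ge0 // sumr_ge0.
have [xE|xn0] := eqVneq x 0.
  by rewrite xE powR0 // mulf_neq0 // ?invr_eq0 pnatr_eq0.
have xgt : 0 < x by rewrite lt_def xn0.
rewrite -(ler_pXn2r (ltn0Sn m.+2)) ?nnegrE ?powR_ge0 //.
rewrite -(powR_mulrn m.+3 (powR_ge0 _ _)) -powRrM divfK ?pnatr_eq0 // powR_mulrn //.
have xn : 0 < x ^+ m.+3 by rewrite exprn_gt0.
rewrite -(ler_pM2l xn) -exprD.
have -> : (m.+3 + m.+1 = m.+2 * 2)%N by lia.
rewrite exprM; apply: le_trans xa _.
rewrite big_split /= big_split /= !prodr_const card_ord.
rewrite [leLHS]mulrCA; apply: ler_wpM2l; first exact: ltW.
have := leif_AGM (A := 'I_m.+3) (E := a) (fun i _ => a0 i).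
rewrite card_ord => -[h _].
have -> : y / m.+3%:R * \sum_i a i = y * ((\sum_i a i) / m.+3%:R).
  by rewrite -mulrA [_^-1 * _]mulrC.
by rewrite [leRHS]exprMn; apply: ler_wpM2l => //; rewrite exprn_ge0.
Qed.

Lemma intOnE b n (Omega : set 'rV[R]_n) (f : 'rV[R]_n -> R) : 0 <= b ->
  boxed b n (fun s => f (row_of n s)) -> (forall x, ~ Omega x -> f x = 0) ->
  intOn Omega f = (iterint n (fun s => f (row_of n s)))%:E.
Proof.
move=> b0 nf f0; rewrite -(iintE b0 nf); apply: eq_iint => s _ /=; congr _%:E.
rewrite indicE -/(row_of n s).
by have [/set_mem Ox|/negP Ox] := boolP (row_of n s \in Omega); rewrite ?mul1r //
  f0 ?mulr0 // => Ox'; apply: Ox; rewrite inE.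
Qed.

(** * The estimate for a fixed function with compact support *)

Section Estimate.
Variables (m k : nat) (u : 'rV[R]_m.+3 -> R) (K : set 'rV[R]_m.+3) (b e : R).
Hypotheses (su : smooth u) (cK : compact K) (u0 : forall x, ~ K x -> u x = 0).
Hypotheses (b0 : 0 <= b) (Kb : forall x, K x -> forall i, `|x ord0 i| <= b).
Hypotheses (e0 : 0 < e)
  (Ke : forall x, K x -> forall i : 'I_m.+3, (i < k)%N -> e <= x ord0 i).
Local Notation n := (m.+3).
Implicit Types (i : 'I_n) (s : seq R).

Let U s := u (row_of n s).
Let D i s := partial i u (row_of n s).
(** The indicator factor treats the coordinates with and without a Hardy weight uniformly. *)
Let V i s : R := (i < k)%:R * (U s / nth 0 s i).
Let g i s := D i s - 2^-1 * V i s.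

Lemma differentiable_u x : differentiable u x. Proof. exact: (su [::] x). Qed.

Lemma continuous_u : continuous u.
Proof. by move=> x; apply: differentiable_continuous; exact: differentiable_u. Qed.

Lemma continuous_partial i : continuous (partial i u).
Proof. by move=> x; apply: differentiable_continuous; exact: (su [:: i] x). Qed.

Lemma partial_eq0_off i x : ~ K x -> partial i u x = 0.
Proof. exact: partial_eq0. Qed.

Lemma box_K s : size s = n -> K (row_of n s) -> box b s.
Proof.
move=> sn Ks; apply/(all_nthP 0) => i; rewrite sn => ilt.
by have := Kb Ks (Ordinal ilt); rewrite mxE.
Qed.

Lemma sboxed_row f : continuous f -> (forall x, ~ K x -> f x = 0) ->
  sboxed b n (fun s => f (row_of n s)).
Proof.
move=> cf f0; have [M M0 fM] := compact_continuous_bounded cK cf.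
apply: (@sboxedP _ _ _ M) => //; first exact: tmeasurable_continuous.
move=> s sn; have [Ks|nKs] := pselect (K (row_of n s)).
  by rewrite box_K // mulr1; exact: fM.
by rewrite f0 // normr0 mulr_ge0.
Qed.

Lemma sboxed_U : sboxed b n U. Proof. exact: sboxed_row continuous_u u0. Qed.

Lemma sboxed_D i : sboxed b n (D i).
Proof. exact: sboxed_row (@continuous_partial i) (@partial_eq0_off i). Qed.

Lemma coord_ge_U s i : size s = n -> (i < k)%N -> U s != 0 -> e <= nth 0 s i.
Proof.
move=> sn ik Us; have [Ks|/u0] := pselect (K (row_of n s)); last first.
  by rewrite -/(U s) => Us0; rewrite Us0 eqxx in Us.
by have := Ke Ks ik; rewrite mxE.
Qed.

(** Where u is nonzero the coordinate is at least [e], so |u / x_i| is at most M / e. *)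
Lemma sboxed_V i : sboxed b n (V i).
Proof.
have [ik|ik] := boolP (i < k)%N; last first.
  rewrite /V (negbTE ik); apply: (@sboxedP _ _ _ 0) => //.
    by under eq_fun do rewrite mul0r; exact: measurable_cst.
  by move=> s _; rewrite !mul0r normr0.
have [M M0 UM] := sboxed_bound sboxed_U.
apply: (@sboxedP _ _ _ (M * e^-1)).
(* Measurability comes from the power -1, which agrees with the inverse on nonnegative numbers;
   where the coordinate is negative, [U] is 0 and both products vanish. *)
- apply: (@eq_tmeasurable _ _ (fun s => U s * nth 0 s i `^ (-1))).
    move=> s sn; rewrite /V ik mul1r.
    have [->|Us] := eqVneq (U s) 0; first by rewrite !mul0r.
    by rewrite powR_inv1 // (le_trans (ltW e0)) // coord_ge_U.
  apply: measurable_funM; first by case: sboxed_U.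
  have mi : measurable_fun setT (fun s : n.-tuple R => nth 0 s i) := @tmeasurable_nth R n i.
  exact: (measurableT_comp (measurable_powR (-1)) mi).
- by rewrite divr_ge0 // ltW.
- move=> s sn; rewrite /V ik mul1r.
  have [->|Us] := eqVneq (U s) 0.
    by rewrite !mul0r normr0 !mulr_ge0 // invr_ge0 ltW.
  have es := coord_ge_U sn ik Us; have s0 := lt_le_trans e0 es.
  rewrite mulrAC normrM; apply: ler_pM => //; first exact: UM.
  by rewrite normfV gtr0_norm // lef_pV2.
Qed.

Lemma sboxed_g i : sboxed b n (g i).
Proof. exact: sboxedB (sboxed_D i) (sboxedZ _ (sboxed_V i)). Qed.

Lemma is_derive_U s i t : size s = n ->
  is_derive t (1 : R) (fun t : R => U (set_nth 0 s i t)) (D i (set_nth 0 s i t)).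
Proof.
move=> sn; rewrite /D /U row_of_set_nth //.
under eq_fun do rewrite row_of_set_nth //.
exact: is_derive_line differentiable_u.
Qed.

Lemma continuous_D s i : size s = n -> continuous (fun t => D i (set_nth 0 s i t)).
Proof.
move=> sn; rewrite /D; under eq_fun do rewrite row_of_set_nth //.
exact: continuous_line (@continuous_partial i).
Qed.

Lemma fiber_eq0_off s i t : size s = n -> (b < t) || (i < k)%N && (t < e) ->
  U (set_nth 0 s i t) = 0 /\ D i (set_nth 0 s i t) = 0.
Proof.
move=> sn ht; suff nK : ~ K (row_of n (set_nth 0 s i t)).
  by split; [exact: u0|exact: partial_eq0_off].
move=> Ks; move: (Kb Ks i) (Ke Ks (i := i)); rewrite mxE nth_set_nth_if eqxx.
move=> h1 h2; have := le_trans (ler_norm t) h1.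
case/orP: ht => [bt|/andP[ik te] _]; first by rewrite leNgt bt.
by have := h2 ik; rewrite leNgt te.
Qed.

(** Passes from inserting a coordinate, as in [iterint_ins], to replacing one, as in fibres; [x] is
    an arbitrary placeholder. *)
Lemma ins_set_nth (s : seq R) j t x : (j <= size s)%N ->
  ins j t s = set_nth 0 (ins j x s) j t.
Proof.
move=> js; have tk : size (take j s) = j by rewrite size_take_min; apply/minn_idPl.
have sz y : size (ins j y s) = (size s).+1.
  by rewrite /ins size_cat /= addnS -size_cat cat_take_drop.
apply: (@eq_from_nth _ 0) => [|l _]; first by rewrite size_set_nth_ltn !sz.
rewrite nth_set_nth_if /ins !nth_cat tk.
case: ltngtP => [//|lj|->]; last by rewrite subnn.
by rewrite -(subnKC lj) addSnnS addKn.
Qed.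

(** The [i]-th coordinate is integrated innermost and [hardy_identity] is applied on each line. For
    a coordinate without Hardy weight, [V i] is 0 and [g i] is [D i]. *)
Lemma hardy_iterint i : iterint n (fun s => D i s ^+ 2) =
  iterint n (fun s => g i s ^+ 2) + 4^-1 * iterint n (fun s => V i s ^+ 2).
Proof.
have nD := boxed_sqr (sboxed_D i).
have ng := boxed_sqr (sboxed_g i); have nV := boxed_sqr (sboxed_V i).
have q0 : 0 <= 4^-1 :> R by rewrite invr_ge0.
have nZ := boxedZ q0 nV.
rewrite -(iterintZ b0 q0 nV) -(iterintD b0 ng nZ).
have [ik|ik] := boolP (i < k)%N; last first.
  apply: eq_iterint => s _; rewrite /g /V (negbTE ik) mul0r mulr0 subr0.
  by rewrite expr0n mulr0 addr0.
have im : (i <= m.+2)%N by rewrite -ltnS.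
rewrite (iterint_ins b0 nD im) (iterint_ins b0 (boxedD ng nZ) im); apply: eq_iterint => s' sm.
have is' : (i <= size s')%N by rewrite sm.
pose s := ins i 0 s'.
have sn : size s = n by rewrite /s /ins size_cat /= addnS -size_cat cat_take_drop sm.
have insE t : ins i t s' = set_nth 0 s i t by exact: ins_set_nth.
pose f t := U (set_nth 0 s i t); pose f' t := D i (set_nth 0 s i t).
have iD : mu.-integrable setT (EFin \o (fun t => f' t ^+ 2)).
  exact: boxed1_integrable (boxed1_fiber nD (ltn_ord i) sn).
have qE t : g i (set_nth 0 s i t) ^+ 2 + 4^-1 * V i (set_nth 0 s i t) ^+ 2 =
    (f' t - f t / (2 * t)) ^+ 2 + 4^-1 * ((t ^+ 2)^-1 * f t ^+ 2).
  rewrite /g /V ik mul1r nth_set_nth_if eqxx -/(f t) -/(f' t).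
  by rewrite invfM exprMn exprVn; congr (_ ^+ 2 + _); ring.
(* The maximum ensures that the left end does not exceed the right one: [b < e] is possible when [K]
   is empty. *)
have := @hardy_identity R f f' e (Num.max b e) e0.
rewrite le_max lexx orbT => /(_ isT) H.
under eq_Rintegral do rewrite insE.
under [RHS]eq_Rintegral do rewrite insE qE.
apply: H => //.
- by move=> t; exact: is_derive_U.
- exact: continuous_D.
- move=> t ht; apply: fiber_eq0_off => //; rewrite ik /=.
  by move: ht; rewrite negb_and -!ltNge gt_max orbC => /orP[/andP[->]|->] //; rewrite orbT.
have := boxed1_integrable b0 (boxed1_fiber (boxedD ng nZ) (ltn_ord i) sn).
by congr (_.-integrable _ _); apply/funext => t /=; rewrite qE.
Qed.

(* [r = 1 / (n - 2)] *)
Let r : R := m.+1%:R^-1.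
(** This is q |u|^(q-1) |g_i|, with q = 2 (r + 1). *)
Let G i s := (r + 1) * 2 * (`|U s| `^ (2 * r + 1) * `|g i s|).

Lemma r_gt0 : 0 < r. Proof. by rewrite /r invr_gt0. Qed.

Lemma boxed_absU q : 0 < q -> boxed b n (fun s => `|U s| `^ q).
Proof. by move=> q0; apply: boxed_powR => //; case: sboxed_U. Qed.

Lemma boxed_G i : boxed b n (G i).
Proof.
have r0 := r_gt0.
apply: boxedZ; first by lra.
apply: boxedM; last by case: (sboxed_g i).
by apply: boxed_absU; lra.
Qed.

Lemma fiber_bound i s : size s = n -> (U s ^+ 2) `^ (r + 1) <= fiber_int i (G i) s.
Proof.
move=> sn; pose f t := U (set_nth 0 s i t); pose f' t := D i (set_nth 0 s i t).
have -> : U s = f (nth 0 s i).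
  rewrite /f; congr (U _); apply: (@eq_from_nth _ 0).
    by rewrite size_set_nth_ltn sn.
  by move=> j _; rewrite nth_set_nth_if; case: eqP => // ->.
(* [b + 1] and not [b]: vanishing is required from the threshold on, but is known only strictly
   beyond [b]. *)
apply: (@powR_le_Rintegral R f f' (fun t => g i (set_nth 0 s i t)) r (b + 1)).
- exact: r_gt0.
- by move=> t; exact: is_derive_U.
- exact: continuous_D.
- by move=> t bt; have [] := @fiber_eq0_off s i t sn _; [apply/orP; left; lra|].
(* For a weighted coordinate the product is u^2 / (2 t), and t >= e > 0 wherever u is nonzero. *)
- move=> t; rewrite /g opprB addrC subrK /V -/(f t) nth_set_nth_if eqxx.
  have [ik|ik] := boolP (i < k)%N; last by rewrite mul0r !mulr0.
  have [->|ft] := eqVneq (f t) 0; first by rewrite mul0r.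
  have := @coord_ge_U (set_nth 0 s i t) i _ ik ft.
  rewrite size_set_nth_ltn sn // nth_set_nth_if eqxx => /(_ erefl) et.
  have t0 : 0 < t^-1 by rewrite invr_gt0 (lt_le_trans e0).
  have -> : f t * (2^-1 * (1 * (f t / t))) = 2^-1 * (f t ^+ 2 * t^-1) by ring.
  apply: mulr_ge0; first by rewrite invr_ge0.
  by apply: mulr_ge0; [exact: sqr_ge0|exact: ltW].
- exact: boxed1_integrable (boxed1_fiber (boxed_G i) (ltn_ord i) sn).
Qed.

(* [p] is the critical exponent and [q = p / 2 + 1]. *)
Let p : R := 2 * (2 * r + 1).
Let q : R := 2 * (r + 1).
Let S := iterint n (fun s => `|U s| `^ p).
Let E i := iterint n (fun s => g i s ^+ 2).

Lemma iterint_G_sqr i : iterint n (G i) ^+ 2 <= (q ^+ 2) * (S * E i).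
Proof.
have r0 := r_gt0.
have p0 : 0 < p by rewrite /p; lra.
apply: (@cauchy_schwarz_iterint b) => //; first exact: sqr_ge0.
- exact: boxed_G.
- exact: boxed_absU.
- exact: boxed_sqr (sboxed_g i).
move=> s sn.
rewrite le_eqVlt; apply/orP; left; apply/eqP.
rewrite /G !exprMn -(powR_mulrn 2 (powR_ge0 _ _)) -powRrM real_normK ?num_real //.
have -> : (2 * r + 1) * 2 = p by rewrite /p; lra.
by rewrite /q; ring.
Qed.

(** Loomis-Whitney applies to |u|^p because p (n - 1) = q n: the power n - 1 of |u|^p is a product
    of n copies of |u|^q, one for each fibre bound. *)
Lemma gagliardo_nirenberg_pow : S ^+ m.+2 <= \prod_i iterint n (G i).
Proof.
have r0 := r_gt0.
have p0 : 0 < p by rewrite /p; lra.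
have -> : \prod_i iterint n (G i) = \prod_(i < n) iterint n (G (inord i)).
  by apply: eq_bigr => i _; rewrite inord_val.
apply: (@loomis_whitney R b b0 m.+1 _ (fun j => G (inord j))).
- exact: boxed_absU.
- by move=> i _; exact: boxed_G.
move=> s sn.
have -> : (`|U s| `^ p) ^+ m.+2 = \prod_(i < n) (U s ^+ 2) `^ (r + 1).
  have -> : (U s ^+ 2) `^ (r + 1) = `|U s| `^ q.
    by rewrite -(@powR_sqr_norm R (U s) q); congr (_ `^ _); rewrite /q; field.
  rewrite prodr_const card_ord.
  rewrite -(powR_mulrn m.+2 (powR_ge0 _ _)) -(powR_mulrn n (powR_ge0 _ _)) -!powRrM.
  congr (_ `^ _).
  have m1 : m.+1%:R != 0 :> R by rewrite pnatr_eq0.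
  rewrite /p /q /r.
  have -> : m.+2%:R = m.+1%:R + 1 :> R by rewrite -natr1.
  have -> : m.+3%:R = m.+1%:R + 2 :> R by rewrite -natrD addn2.
  by field.
apply: ler_prod => i _; rewrite powR_ge0 /= inord_val; exact: fiber_bound.
Qed.

Lemma sobolev_iterint : S `^ (2 / p) <= q ^+ 2 / n%:R * \sum_i E i.
Proof.
have r0 := r_gt0.
have p0 : 0 < p by rewrite /p; lra.
have -> : 2 / p = m.+1%:R / m.+3%:R.
  rewrite /p /r; have -> : m.+3%:R = m.+1%:R + 2 :> R by rewrite -natrD addn2.
  field; have := ler0n R m => m0.
  by apply/andP; split; apply: lt0r_neq0; lra.
apply: geometric_arithmetic_bound.
- exact: (iterint_ge0 b0 (boxed_absU p0)).
- exact: sqr_ge0.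
- by move=> i; exact: (iterint_ge0 b0 (boxed_sqr (sboxed_g i))).
have J0 i : 0 <= iterint n (G i) by exact: (iterint_ge0 b0 (boxed_G i)).
apply: (@le_trans _ _ ((\prod_i iterint n (G i)) ^+ 2)).
  by apply: lerXn2r; rewrite ?nnegrE ?exprn_ge0 ?prodr_ge0 //;
    [exact: (iterint_ge0 b0 (boxed_absU p0))|exact: gagliardo_nirenberg_pow].
rewrite -prodrXl; apply: ler_prod => i _; apply/andP; split; first exact: sqr_ge0.
exact: iterint_G_sqr.
Qed.

Lemma crit_expE : crit_exp R n = p.
Proof.
have m0 := ler0n R m; rewrite /crit_exp /p /r.
have -> : m.+3%:R = m.+1%:R + 2 :> R by rewrite -natrD addn2.
by field; repeat (apply/andP; split); apply: lt0r_neq0; lra.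
Qed.

Lemma hardy_weightE s : size s = n ->
  (\sum_(i < n | (i < k)%N) (row_of n s ord0 i ^+ 2)^-1) * u (row_of n s) ^+ 2 =
  \sum_i V i s ^+ 2.
Proof.
move=> sn; rewrite mulr_suml big_mkcond /=; apply: eq_bigr => i _.
rewrite /V mxE; case: ifP => _; last by rewrite mul0r expr0n.
by rewrite mul1r exprMn exprVn mulrC.
Qed.

Lemma hardy_sobolev_intOn (Omega : set 'rV[R]_n) : K `<=` Omega ->
  ((1 / 4)%:E * intOn Omega (fun x =>
      (\sum_(i < n | (i < k)%N) (x ord0 i ^+ 2)^-1) * u x ^+ 2)%R
   + (n%:R / q ^+ 2)%:E * (intOn Omega (fun x => `|u x| `^ crit_exp R n)%R)
       `^ (2 / crit_exp R n)%R <= intOn Omega (grad_norm2 u))%E.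
Proof.
move=> KO.
have r0 := r_gt0.
have p0 : 0 < p by rewrite /p; lra.
have q0 : 0 < q by rewrite /q; lra.
have uO x : ~ Omega x -> u x = 0 by move=> nO; apply: u0 => /KO.
have nD i : boxed b n (fun s => D i s ^+ 2) := boxed_sqr (sboxed_D i).
have nV i : boxed b n (fun s => V i s ^+ 2) := boxed_sqr (sboxed_V i).
have ng i : boxed b n (fun s => g i s ^+ 2) := boxed_sqr (sboxed_g i).
rewrite crit_expE.
rewrite (@intOnE b n Omega (grad_norm2 u)) //; last 2 first.
- by apply: (boxed_sum (index_enum _) (fun i _ => nD i)).
- move=> x nO; apply: big1 => i _; rewrite partial_eq0_off ?expr0n //.
  by move=> /KO.
rewrite (@intOnE b n Omega (fun x =>
    (\sum_(i < n | (i < k)%N) (x ord0 i ^+ 2)^-1) * u x ^+ 2)) //; last 2 first.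
- apply: eq_boxed (boxed_sum _ (fun i _ => nV i)) => s sn.
  by rewrite hardy_weightE.
- by move=> x /uO ->; rewrite expr0n mulr0.
rewrite (@intOnE b n Omega (fun x => `|u x| `^ p)) //; last 2 first.
- exact: boxed_absU.
- by move=> x /uO ->; rewrite normr0 powR0 // gt_eqF.
rewrite poweR_EFin -!EFinM -EFinD lee_fin.
rewrite (eq_iterint (hardy_weightE)) (iterint_sum b0 _ (fun i _ => nV i)).
rewrite (iterint_sum b0 _ (fun i _ => nD i)).
(* The Hardy terms now agree on both sides and cancel; what remains is [sobolev_iterint]. *)
under [leRHS]eq_bigr => i _ do rewrite hardy_iterint.
rewrite big_split /= -mulr_sumr [leRHS]addrC div1r lerD2l.
have n0 : 0 < n%:R :> R by rewrite ltr0n.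
have := sobolev_iterint; rewrite -/S; set A := \sum_i E i => h.
rewrite mulrAC ler_pdivrMr ?exprn_gt0 //.
move: h; rewrite mulrAC ler_pdivlMr // mulrC => h.
by rewrite [leRHS]mulrC.
Qed.
End Estimate.
End HardySobolev.

(** * Compact subsets of the orthant, and the constant *)

Lemma compact_orthant_gap (R : realType) n k (K : set 'rV[R]_n) : compact K ->
  K `<=` @Rnkplus R n k ->
  exists2 e : R, 0 < e &
    forall x, K x -> forall i : 'I_n, (i < k)%N -> e <= x ord0 i.
Proof.
move=> cK KO.
have /choice[a ha] : forall i : 'I_n, exists a : R, 0 < a /\
    forall x, K x -> (i < k)%N -> a <= x ord0 i.
  move=> i; have [ik|ik] := boolP (i < k)%N; last by exists 1.
  have [a a0 Ka] := compact_coord_gt0 cK (fun x Kx => KO x Kx i ik).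
  by exists a; split=> // x /Ka.
have a0 i : 0 < a i by case: (ha i).
have s0 (P : pred 'I_n) : 0 <= \sum_(i | P i) (a i)^-1.
  by apply: sumr_ge0 => i _; rewrite invr_ge0 ltW.
(* A positive number below every [a i], obtained without taking a minimum. *)
exists (1 + \sum_i (a i)^-1)^-1; first by rewrite invr_gt0 ltr_pwDl.
move=> x Kx i ik; apply: le_trans ((ha i).2 x Kx ik).
rewrite -[leRHS]invrK lef_pV2 ?posrE ?invr_gt0 ?ltr_pwDl //.
rewrite (bigD1 i) //= addrCA lerDl.
by rewrite addr_ge0.
Qed.

Theorem theorem4p1 (R : realType) (n k : nat)
  (hn : (3 <= n)%N) (hk1 : (1 <= k)%N) (hkn : (k <= n)%N) :
  exists C : R, 0 < C /\
    forall u : 'rV[R]_n -> R, Cc_infty (@Rnkplus R n k) u ->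
      (intOn (@Rnkplus R n k) (grad_norm2 u) >=
       (1 / 4)%:E * intOn (@Rnkplus R n k)
          (fun x => (\sum_(i < n | (i < k)%N) (x ord0 i ^+ 2)^-1) * u x ^+ 2)%R
       + C%:E * (intOn (@Rnkplus R n k) (fun x => `|u x| `^ crit_exp R n)%R)
                `^ (2 / crit_exp R n)%R)%E.
Proof.
case: n hn hkn => [|[|[|m]]] // _ hkn.
(* With n = m + 3 this is 2 (n - 1) / (n - 2), so the constant is n (n - 2)^2 / (4 (n - 1)^2), the
   same for all k. *)
pose q : R := 2 * (m.+1%:R^-1 + 1).
have q0 : 0 < q by rewrite mulr_gt0 // ltr_wpDl // invr_ge0.
exists (m.+3%:R / q ^+ 2); split; first by rewrite divr_gt0 // exprn_gt0.
move=> u [su [K [cK KO u0]]].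
have [b b0 Kb] := compact_coord_bounded cK.
have [e e0 Ke] := compact_orthant_gap cK KO.
exact: hardy_sobolev_intOn su cK u0 b0 Kb e0 Ke _ KO.
Qed.
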